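(* For any integers $p\ge 1$ and $k_{1},\dots,k_{p}\ge1$, there is $n_{0}=n_{0}(k_{1},\dots,k_{p})$ such that the following holds. If $n_{1},\dots,n_{p}\ge n_{0}$ and $\mathcal{F}\subseteq\prod_{s=1}^p\binom{[n_s]}{k_s}$ is a non-trivially intersecting family, then \[ |\mathcal{F}| \le M^{\max}(n_{1},\dots,n_{p},k_{1},\dots,k_{p}):= \max M_{t,S}^{\mathrm{HM}}, \] where the maximum is over all $t\in [p]$ and $S\subseteq [p]\setminus \{t\}$, excluding the pair $(t,S)$ with $S=\emptyset$ when $k_t=1$, and excluding the pairs $(t,S)$ with $S=\{r\}$ when $k_t=k_r=1$ (for some $r$). Here, for $k_t>1$, \[ M_{t,S}^{\mathrm{HM}}:=\left(\binom{n_{t}-1}{k_{t}-1}\prod_{s\in S}\binom{n_{s}}{k_{s}}-\binom{n_{t}-k_{t}-1}{k_{t}-1}\prod_{s\in S}\binom{n_{s}-k_{s}}{k_{s}}+1\right)\prod_{s\notin S\cup\{ t\} }\binom{n_{s}}{k_{s}}, \] and for $k_t=1$, \[ M_{t,S}^{\mathrm{HM}}:=\left(\prod_{s\in S}\binom{n_{s}}{k_{s}}-\prod_{s\in S}\binom{n_{s}-k_s}{k_{s}}+(n_{t}-1)\right)\prod_{s\notin S\cup\{ t\} }\binom{n_{s}}{k_{s}}. \] (If the set of admissible pairs $(t,S)$ is empty, no non-trivially intersecting family exists and the statement holds vacuously.)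
   Context: Multi-part setting: for $p\ge1$ and positive integers $n_1,\dots,n_p$, the ground set is the disjoint union $\bigsqcup_{s=1}^p [n_s]$ of $p$ parts, where $[n]=\{1,\dots,n\}$. For $F_s\subseteq[n_s]$, $\bigsqcup_s F_s$ denotes the subset of the ground set having $F_s$ in part $s$. For $k_s\in[n_s]$, $\prod_{s}\binom{[n_s]}{k_s}$ denotes the collection of all sets $\bigsqcup_s F_s$ with $|F_s|=k_s$ for every $s$. A family $\mathcal{F}$ of such sets is intersecting if any two of its sets intersect (i.e. for any $\bigsqcup_s F_s,\bigsqcup_s G_s\in\mathcal F$ there is a part $s$ with $F_s\cap G_s\neq\emptyset$); it is trivially intersecting if some element of the ground set (a given element $i$ in a given part $s$) lies in every set of $\mathcal F$; it is non-trivially intersecting if it is intersecting but not trivially intersecting. *)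

(* Defs.v *)
From mathcomp Require Import all_boot.
Set Implicit Arguments. Unset Strict Implicit. Unset Printing Implicit Defensive.

Definition ground (p : nat) (n : 'I_p -> nat) : finType :=
  {s : 'I_p & 'I_(n s)}.

Definition part (p : nat) (n : 'I_p -> nat) (A : {set ground n}) (s : 'I_p)
  : {set 'I_(n s)} := [set i | Tagged (fun s => 'I_(n s)) i \in A].

Definition in_prod_binom (p : nat) (n k : 'I_p -> nat) (A : {set ground n}) :=
  forall s : 'I_p, #|part A s| = k s.

Definition intersecting (p : nat) (n : 'I_p -> nat) (F : {set {set ground n}}) :=
  forall A B, A \in F -> B \in F -> A :&: B != set0.

Definition trivially_intersecting (p : nat) (n : 'I_p -> nat)
  (F : {set {set ground n}}) :=
  exists x : ground n, forall A, A \in F -> x \in A.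

Definition nontrivially_intersecting (p : nat) (n : 'I_p -> nat)
  (F : {set {set ground n}}) :=
  intersecting F /\ ~ trivially_intersecting F.

(* M^HM_{t,S}. All subtractions are of a smaller from a larger natural number
   (binomials are monotone), so truncated subtraction is exact. *)
Definition MHM (p : nat) (n k : 'I_p -> nat) (t : 'I_p) (S : {set 'I_p}) : nat :=
  (if 1 < k t then
     'C(n t - 1, k t - 1) * (\prod_(s in S) 'C(n s, k s))
     - 'C(n t - k t - 1, k t - 1) * (\prod_(s in S) 'C(n s - k s, k s)) + 1
   else
     (\prod_(s in S) 'C(n s, k s)) - (\prod_(s in S) 'C(n s - k s, k s))
     + (n t - 1))
  * \prod_(s | s \notin t |: S) 'C(n s, k s).

Definition admissible (p : nat) (k : 'I_p -> nat) (t : 'I_p) (S : {set 'I_p}) : bool :=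
  [&& t \notin S,
      ~~ ((S == set0) && (k t == 1)) &
      ~~ [exists r : 'I_p, [&& S == [set r], k t == 1 & k r == 1]]].

Definition Mmax (p : nat) (n k : 'I_p -> nat) : nat :=
  \max_(t : 'I_p) \max_(S : {set 'I_p} | admissible k t S) MHM n k t S.

(* Main.v *)
Require Import Defs.
From mathcomp Require Import all_boot all_order all_algebra.
From mathcomp Require Import zify ring lra.
Set Implicit Arguments. Unset Strict Implicit. Unset Printing Implicit Defensive.

(** Enlarge F to a maximal intersecting family, so that transversals (sets of at most k_s elements
    in each part s that meet every member) meet pairwise; since F is non-trivial none is a
    singleton. Suppose |F| > M^max and give an element of part s the weight 1/n_s. Every admissible
    pair {a, b} lies in a Hilton-Milner family, so w_a w_b N <= M^max with N the size of the product,
    whereas sets containing a fixed triple are fewer by a large factor. Branching over members of F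
    hence yields a transversal of size two (an "edge"), and the edges form a star or a triangle.
    For a star with centre x and leaves Y, filling up the parts where Y is incomplete gains about
    w_x w_s N sets through x, more than all the sets of F that do not contain x and a leaf.
    For a triangle {x, y, z}, F consists of sets with two elements in it; it is either a
    Hilton-Milner family itself or is beaten by adding leaves, with centre x or z chosen by an
    exact comparison of binomial products. *)

(** * Counting sets with prescribed part sizes *)
Section Counting.
Variables (p : nat) (n k : 'I_p -> nat).
Local Notation G := (ground n).
Implicit Types (A B I U Y : {set G}) (s : 'I_p) (v x y : G).

Definition fiber s : {set G} := [set v | tag v == s].
Definition sz A s : nat := #|A :&: fiber s|.
Definition allowed A := [forall s, sz A s <= k s].
Definition prodfam : {set {set G}} := [set A | [forall s, sz A s == k s]].

Lemma Tagged_injective s : injective (Tagged (fun s => 'I_(n s)) : 'I_(n s) -> G).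
Proof. by move=> i j /eqP; rewrite eq_Tagged => /eqP. Qed.

Lemma part_size A s : #|part A s| = sz A s.
Proof.
rewrite /sz -(card_imset _ (@Tagged_injective s)); congr #|pred_of_set _|.
apply/setP=> v; apply/imsetP/idP => [[i iA ->]|].
  by move: iA; rewrite !inE => -> /=.
rewrite !inE => /andP[vA /eqP vs]; case: v vA vs => r i vA /= rs.
by subst r; exists i; rewrite ?inE.
Qed.

Lemma card_fiber s : #|fiber s| = n s.
Proof.
have := part_size setT s; rewrite /sz setTI => <-.
by rewrite -[RHS]card_ord; apply: eq_card => i; rewrite !inE.
Qed.

Lemma prodfamP A : reflect (forall s, sz A s = k s) (A \in prodfam).
Proof. by rewrite inE; apply: (iffP forallP) => h s; apply/eqP; apply: h. Qed.

Lemma card_sz A : #|A| = \sum_s sz A s.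
Proof.
rewrite -sum1_card (partition_big (fun v : G => tag v) predT) //=.
by apply: eq_bigr => s _; rewrite /sz -sum1_card; apply: eq_bigl => v; rewrite !inE.
Qed.

Lemma sz_gt0 A v : v \in A -> 0 < sz A (tag v).
Proof. by move=> vA; apply/card_gt0P; exists v; rewrite !inE vA eqxx. Qed.

Lemma sz_subset A B s : A \subset B -> sz A s <= sz B s.
Proof. by move=> AB; apply: subset_leq_card; apply: setSI. Qed.

Lemma allowed_subset A B : A \subset B -> allowed B -> allowed A.
Proof.
by move=> AB /forallP hB; apply/forallP => s; apply: leq_trans (hB s); apply: sz_subset.
Qed.

Lemma prodfam_allowed A : A \in prodfam -> allowed A.
Proof. by move=> /prodfamP hA; apply/forallP => s; rewrite hA. Qed.

Lemma sz_setU1 A v s : v \notin A -> sz (v |: A) s = (tag v == s) + sz A s.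
Proof.
move=> vA; rewrite /sz setIUl; case: (eqVneq (tag v) s) => [vs|vs].
  have -> : [set v] :&: fiber s = [set v].
    by apply/setIidPl; rewrite sub1set inE vs.
  by rewrite cardsU1 !inE (negPf vA).
have -> : [set v] :&: fiber s = set0.
  by apply/setP=> u; rewrite !inE; case: eqP => // ->; rewrite (negPf vs).
by rewrite set0U.
Qed.

Lemma sz_set0 s : sz set0 s = 0.
Proof. by rewrite /sz set0I cards0. Qed.

Lemma sz_set1 v s : sz [set v] s = (tag v == s).
Proof. by rewrite -[[set v]]setU0 sz_setU1 ?inE // sz_set0 addn0. Qed.

(** A set is determined by its traces on the fibers, and these can be prescribed independently: [g]
    is a bijection onto the functions choosing a trace in each [Q s], with union as inverse. *)
Lemma card_prod_fibers (Q : 'I_p -> {set {set G}}) :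
  (forall s B, B \in Q s -> B \subset fiber s) ->
  #|[set A | [forall s, A :&: fiber s \in Q s]]| = \prod_s #|Q s|.
Proof.
move=> Qsub.
have -> : \prod_s #|Q s| = #|family (fun s => mem (Q s))|.
  by rewrite card_family foldrE big_map big_enum.
pose g (A : {set G}) := [ffun s => A :&: fiber s].
have ginj : injective g.
  move=> A B /ffunP eqAB; apply/setP => v.
  by have := eqAB (tag v); rewrite !ffunE => /setP/(_ v); rewrite !inE eqxx !andbT.
rewrite -(card_imset _ ginj); apply: eq_card => f; apply/imsetP/idP.
  case=> A; rewrite inE => /forallP hA ->; apply/familyP => s.
  by rewrite ffunE; apply: hA.
move=> /familyP hf; exists (\bigcup_s f s); last first.
  apply/ffunP => s; rewrite ffunE; apply/setP => v; rewrite !inE.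
  apply/idP/andP => [vf|[/bigcupP[r _ vfr] /eqP vs]].
    split; first by apply/bigcupP; exists s.
    by have /subsetP/(_ v vf) := Qsub _ _ (hf s); rewrite inE.
  by have /subsetP/(_ v vfr) := Qsub _ _ (hf r); rewrite inE vs => /eqP ->.
rewrite inE; apply/forallP => s.
suff -> : (\bigcup_r f r) :&: fiber s = f s by apply: hf.
apply/setP => v; rewrite !inE; apply/andP/idP => [[/bigcupP[r _ vfr] /eqP vs]|vf].
  by have /subsetP/(_ v vfr) := Qsub _ _ (hf r); rewrite inE vs => /eqP ->.
split; first by apply/bigcupP; exists s.
by have /subsetP/(_ v vf) := Qsub _ _ (hf s); rewrite inE.
Qed.

Definition cnt I U : nat :=
  #|[set A in prodfam | (I \subset A) && [disjoint A & U]]|.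

(** Removing [I] gives a bijection onto the subsets of [V :\: (I :|: U)] of size [m - #|I|]. The
    bound [#|I| <= m] guards the truncated subtraction: beyond it the binomial is 1 while nothing is
    counted. *)
Lemma cards_between (V I U : {set G}) m :
  I \subset V -> U \subset V -> [disjoint I & U] -> #|I| <= m ->
  #|[set B : {set G} | [&& B \subset V, #|B| == m, I \subset B & [disjoint B & U]]]|
    = 'C(#|V| - #|I| - #|U|, m - #|I|).
Proof.
move=> IV UV dIU Im.
have -> : #|V| - #|I| - #|U| = #|V :\: (I :|: U)|.
  rewrite cardsD (setIidPr _); last by rewrite subUset IV UV.
  by rewrite -subnDA cardsU (_ : I :&: U = set0) ?cards0 ?subn0 //; apply/eqP; rewrite setI_eq0.
rewrite -cards_draws -[RHS](card_in_imset (f := fun C => C :|: I)); last first.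
  move=> C D; rewrite !inE => /andP[CV _] /andP[DV _] /setP eqCD.
  apply/setP => v; have := eqCD v; rewrite !inE.
  case vI: (v \in I); last by rewrite !orbF.
  move=> _; have: v \notin V :\: (I :|: U) by rewrite !inE vI.
  by move=> /negPf nv; rewrite (contraFF (subsetP CV v) nv) (contraFF (subsetP DV v) nv).
apply: eq_card => B; rewrite inE; apply/idP/imsetP.
  case/and4P => BV /eqP Bm IB dBU; exists (B :\: I); last first.
    apply/setP => v; rewrite !inE; case vI: (v \in I); rewrite ?orbF // orbT.
    exact: (subsetP IB).
  rewrite !inE cardsD (setIidPr IB) Bm eqxx andbT; apply/subsetP => v.
  rewrite !inE => /andP[vI vB]; rewrite (negPf vI) (subsetP BV) // andbT /=.
  by rewrite disjoint_subset in dBU; have := subsetP dBU v vB; rewrite inE.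
case=> C; rewrite inE => /andP[CV /eqP Cm] ->.
have dCI : C :&: I = set0.
  apply/setP => v; rewrite !inE; apply/negP => /andP[vC vI].
  by have := subsetP CV v vC; rewrite !inE vI.
apply/and4P; split.
- rewrite subUset IV andbT; apply: subset_trans CV _; exact: subsetDl.
- by rewrite cardsU dCI cards0 subn0 Cm subnK.
- exact: subsetUr.
- rewrite disjoint_subset; apply/subsetP => v; rewrite !inE => /orP[vC|vI].
    by have := subsetP CV v vC; rewrite !inE negb_or; case/andP => /andP[].
  by rewrite disjoint_subset in dIU; have := subsetP dIU v vI; rewrite inE.
Qed.

Lemma cnt_prod I U : allowed I -> [disjoint I & U] ->
  cnt I U = \prod_s 'C(n s - sz I s - sz U s, k s - sz I s).
Proof.
move=> /forallP aI dIU.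
pose Q s := [set B : {set G} | [&& B \subset fiber s, #|B| == k s,
   I :&: fiber s \subset B & [disjoint B & U :&: fiber s]]].
have -> : cnt I U = #|[set A | [forall s, A :&: fiber s \in Q s]]|.
  apply: eq_card => A; rewrite !inE; apply/idP/forallP.
    case/and3P => /forallP hA IA dAU s; rewrite inE subsetIr hA setSI //=.
    by rewrite !disjoint_subset in dAU *; apply/subsetP => v; rewrite !inE => /andP[vA _];
      have := subsetP dAU v vA; rewrite inE => /negPf ->.
  move=> hA; apply/and3P; split.
  - by apply/forallP => s; have := hA s; rewrite inE => /and4P[].
  - apply/subsetP => v vI; have := hA (tag v); rewrite inE => /and4P[_ _ /subsetP/(_ v)].
    by rewrite !inE vI eqxx /= => /(_ isT) /andP[].
  - rewrite disjoint_subset; apply/subsetP => v vA.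
    have := hA (tag v); rewrite inE => /and4P[_ _ _].
    rewrite disjoint_subset => /subsetP/(_ v); rewrite !inE vA eqxx !andbT /=.
    exact.
rewrite card_prod_fibers; last by move=> s B; rewrite inE => /and4P[].
apply: eq_bigr => s _; rewrite cards_between ?card_fiber ?subsetIr //.
  rewrite disjoint_subset; apply/subsetP => v; rewrite !inE => /andP[vI _].
  by rewrite disjoint_subset in dIU; have := subsetP dIU v vI; rewrite inE => /negPf ->.
exact: aI.
Qed.

Lemma cnt_sz I U I' U' : allowed I -> [disjoint I & U] -> [disjoint I' & U'] ->
  (forall s, sz I s = sz I' s) -> (forall s, sz U s = sz U' s) ->
  cnt I U = cnt I' U'.
Proof.
move=> aI dIU dIU' eI eU; rewrite !cnt_prod //.
  by apply: eq_bigr => s _; rewrite eI eU.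
by apply/forallP => s; rewrite -eI (forallP aI).
Qed.

(** Each binomial factor of [cnt I U] is positive as soon as every part keeps [k s] elements outside
    [U]. *)
Lemma extend I U : allowed I -> [disjoint I & U] ->
  (forall s, k s + sz U s <= n s) ->
  exists2 A, A \in prodfam & (I \subset A) && [disjoint A & U].
Proof.
move=> aI dIU hn; suff /card_gt0P[A] : 0 < cnt I U.
  by rewrite inE => /andP[? ?]; exists A.
rewrite cnt_prod //; apply/prodn_gt0 => s; rewrite bin_gt0.
have := hn s; have := forallP aI s; lia.
Qed.

(** * Hilton-Milner families with centre [x] and leaf set [Y] *)

Definition HM x Y : {set {set G}} :=
  [set A in prodfam | if x \in A then A :&: Y != set0 else Y \subset A].

Lemma cards_HM x Y : x \notin Y ->
  #|HM x Y| = cnt [set x] set0 - cnt [set x] Y + cnt Y [set x].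
Proof.
move=> xY.
have -> : HM x Y = ([set A in prodfam | ([set x] \subset A) && [disjoint A & set0]]
    :\: [set A in prodfam | ([set x] \subset A) && [disjoint A & Y]])
  :|: [set A in prodfam | (Y \subset A) && [disjoint A & [set x]]].
  apply/setP => A; rewrite !inE !sub1set.
  rewrite [[disjoint A & [set x]]]disjoint_sym disjoints1 -!setI_eq0 setI0 eqxx.
  by case: [forall s, _]; case: (x \in A); case: (A :&: Y == set0); case: (Y \subset A).
rewrite cardsU (_ : (_ :\: _) :&: _ = set0) ?cards0 ?subn0; last first.
  apply/setP => A; rewrite !inE !sub1set [[disjoint A & [set x]]]disjoint_sym disjoints1.
  by case: (x \in A); rewrite ?andbF.
rewrite cardsD (setIidPr _) //; apply/subsetP => A; rewrite !inE => /and3P[-> -> _] /=.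
by rewrite disjoints_subset setC0 subsetT.
Qed.

Lemma prod_split (f : 'I_p -> nat) (t : 'I_p) (S : {set 'I_p}) : t \notin S ->
  \prod_s f s = f t * \prod_(s in S) f s * \prod_(s | s \notin t |: S) f s.
Proof.
move=> tS; rewrite (bigD1 t) //= -mulnA; congr (_ * _).
rewrite (bigID (mem S)) /=; congr (_ * _); apply: eq_bigl => s.
  by rewrite andbC; case sS: (s \in S) => //=; apply: contraNneq tS => <-.
by rewrite !inE negb_or.
Qed.

(* [HM x Y] realises [MHM n k t S] with [t = tag x] and [S = W :\ t]; the part of [x] is filled
   exactly when it has room for leaves. *)
Definition full x Y := [/\ x \notin Y, 1 < #|Y| &
  exists2 W : {set 'I_p}, (forall s, sz Y s = if s \in W then k s else 0) &
    (tag x \in W) = (k (tag x) != 1)].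

Hypothesis k_gt0 : forall s, 0 < k s.

Lemma card_filled Y (W : {set 'I_p}) :
  (forall s, sz Y s = if s \in W then k s else 0) -> #|Y| = \sum_(s in W) k s.
Proof.
by move=> h; rewrite card_sz [RHS]big_mkcond; apply: eq_bigr => s _; apply: h.
Qed.

Lemma allowed1 x : allowed [set x].
Proof. by apply/forallP => s; rewrite sz_set1; have := k_gt0 s; case: eqP; lia. Qed.

(** The condition [1 < #|Y|] yields both exclusions: if [k (tag x) = 1], the part of [x] is not in
    [W], so an empty [W] leaves no leaf at all and [W = [set r]] with [k r = 1] leaves only one. *)
Lemma full_admissible x Y (W : {set 'I_p}) :
  1 < #|Y| -> (forall s, sz Y s = if s \in W then k s else 0) ->
  (tag x \in W) = (k (tag x) != 1) -> admissible k (tag x) (W :\ tag x).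
Proof.
move=> Y1 YW tW; rewrite (card_filled YW) in Y1; apply/and3P; split.
- by rewrite !inE eqxx.
- apply/negP => /andP[/eqP W0 kt]; rewrite kt in tW.
  suff W00 : W = set0 by rewrite W00 big_set0 in Y1.
  by rewrite -W0; apply/setP => s; rewrite !inE; case: eqP => // ->.
- apply/negP => /existsP[r /and3P[/eqP Wr kt /eqP kr]]; rewrite kt in tW.
  suff Wr' : W = [set r] by rewrite Wr' big_set1 kr in Y1.
  by rewrite -Wr; apply/setP => s; rewrite !inE; case: eqP => // ->.
Qed.

(** All three counts of [cards_HM] factor over the parts and share the factor [R]. In the parts of
    [S] a set containing [Y] has no freedom left. In the part of [x] it has none either when
    [k t > 1], which gives the [+ 1]; when [k t = 1] it takes any element but [x], which gives
    [n t - 1]. *)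
Lemma full_HM_le x Y : full x Y -> #|HM x Y| <= Mmax n k.
Proof.
case=> xY Y1 [W YW tW]; set t := tag x in tW.
have adm := full_admissible Y1 YW tW; rewrite -/t in adm.
pose S := W :\ t; have tS : t \notin S by rewrite !inE eqxx.
suff -> : #|HM x Y| = MHM n k t S.
  rewrite /Mmax; apply: leq_trans (leq_bigmax_cond t isT).
  exact: leq_bigmax_cond S adm.
have SW s : s \in S -> s \in W /\ (t == s) = false.
  by rewrite !inE eq_sym => /andP[/negPf ->].
have nSW s : s \notin t |: S -> s \notin W /\ (t == s) = false.
  by rewrite !inE negb_or negb_and eq_sym => /andP[/negPf ->].
have aY : allowed Y by apply/forallP => s; rewrite YW; case: ifP.
have d1 : [disjoint [set x] & Y] by rewrite disjoints1.
rewrite cards_HM // !cnt_prod ?allowed1 ?disjoints1 ?inE //; last by rewrite disjoint_sym.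
rewrite !(prod_split _ tS) !sz_set1 eqxx YW tW !sz_set0 !subn0.
set R := \prod_(s | s \notin t |: S) 'C(n s, k s).
have eR1 : \prod_(s | s \notin t |: S) 'C(n s - sz [set x] s - sz set0 s, k s - sz [set x] s) = R.
  by apply: eq_bigr => s /nSW[_ ts]; rewrite sz_set1 sz_set0 ts !subn0.
have eR2 : \prod_(s | s \notin t |: S) 'C(n s - sz [set x] s - sz Y s, k s - sz [set x] s) = R.
  by apply: eq_bigr => s /nSW[/negPf sW ts]; rewrite sz_set1 YW sW ts !subn0.
have eR3 : \prod_(s | s \notin t |: S) 'C(n s - sz Y s - sz [set x] s, k s - sz Y s) = R.
  by apply: eq_bigr => s /nSW[/negPf sW ts]; rewrite sz_set1 YW sW ts !subn0.
have eS1 : \prod_(s in S) 'C(n s - sz [set x] s - sz set0 s, k s - sz [set x] s)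
   = \prod_(s in S) 'C(n s, k s).
  by apply: eq_bigr => s /SW[_ ts]; rewrite sz_set1 sz_set0 ts !subn0.
have eS2 : \prod_(s in S) 'C(n s - sz [set x] s - sz Y s, k s - sz [set x] s)
   = \prod_(s in S) 'C(n s - k s, k s).
  by apply: eq_bigr => s /SW[sW ts]; rewrite sz_set1 YW sW ts !subn0.
have eS3 : \prod_(s in S) 'C(n s - sz Y s - sz [set x] s, k s - sz Y s) = 1.
  by apply: big1 => s /SW[sW ts]; rewrite sz_set1 YW sW ts subnn bin0.
rewrite eR1 eR2 eR3 eS1 eS2 eS3 /MHM -/R; have kt := k_gt0 t.
have [k1|k1] := ltnP 1 (k t).
  have -> : k t != 1 by lia.
  by rewrite subnn bin0 !mul1n mulnDl mulnBl mul1n subnAC.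
have -> : k t = 1 by lia.
by rewrite /= !subn0 !bin0 bin1 !mul1n muln1 mulnDl [in RHS]mulnBl.
Qed.

(** * Degrees, and their change when an element is added *)

Definition deg I := cnt I set0.

Lemma degE I : deg I = #|[set A in prodfam | I \subset A]|.
Proof.
by apply: eq_card => A; rewrite !inE disjoints_subset setC0 subsetT andbT.
Qed.

Lemma deg_not_allowed I : ~~ allowed I -> deg I = 0.
Proof.
move=> nI; rewrite degE; apply: eq_card0 => A; rewrite inE.
by apply/negP => /andP[/prodfam_allowed aA /allowed_subset /(_ aA)]; apply/negP.
Qed.

Lemma deg_prod I : allowed I -> deg I = \prod_s 'C(n s - sz I s, k s - sz I s).
Proof.
move=> aI; rewrite /deg cnt_prod // ?disjoints_subset ?setC0 ?subsetT //.
by apply: eq_bigr => s _; rewrite sz_set0 subn0.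
Qed.

Lemma deg_subset I (J : {set G}) : I \subset J -> deg J <= deg I.
Proof.
move=> IJ; rewrite !degE; apply: subset_leq_card; apply/subsetP => A.
by rewrite !inE => /andP[-> /(subset_trans IJ)].
Qed.

Lemma cnt_le_deg I U : cnt I U <= deg I.
Proof.
rewrite degE; apply: subset_leq_card; apply/subsetP => A.
by rewrite !inE => /and3P[-> ->].
Qed.

Hypothesis k_le_n : forall s, k s <= n s.

(** Only the factor of the part of [v] changes, by the absorption identity for binomials, here
    cross-multiplied to stay within natural numbers. *)
Lemma deg_setU1_eq I v : v \notin I -> allowed (v |: I) ->
  deg (v |: I) * (n (tag v) - sz I (tag v)) = deg I * (k (tag v) - sz I (tag v)).
Proof.
move=> vI avI; have aI := allowed_subset (subsetUr _ _) avI.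
have szt : sz I (tag v) < k (tag v).
  by have := forallP avI (tag v); rewrite sz_setU1 // eqxx add1n.
rewrite !deg_prod // (bigD1 (tag v)) //= [in RHS](bigD1 (tag v)) //=.
rewrite (_ : \prod_(s | _) _ = \prod_(s | s != tag v) 'C(n s - sz I s, k s - sz I s)); last first.
  by apply: eq_bigr => s sv; rewrite sz_setU1 // eq_sym (negPf sv).
rewrite sz_setU1 // eqxx -mulnAC [RHS]mulnAC; congr (_ * _).
have := mul_bin_diag (n (tag v) - sz I (tag v)) (k (tag v) - sz I (tag v)).-1.
rewrite prednK ?subn_gt0 // [RHS]mulnC => <-.
by rewrite mulnC add1n !subnS.
Qed.

(** With [j] elements of [I] in that part, the exact ratio [(k - j) / (n - j)] is at most [k / n]
    since [k <= n]. *)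
Lemma deg_setU1_le I v : v \notin I -> deg (v |: I) * n (tag v) <= k (tag v) * deg I.
Proof.
move=> vI; case: (boolP (allowed (v |: I))) => [avI|/deg_not_allowed -> //].
have := deg_setU1_eq vI avI; have := k_le_n (tag v).
have := forallP avI (tag v); rewrite sz_setU1 // eqxx add1n.
set m := n _; set j := sz _ _; set h := k _; move=> jh hm eq1.
rewrite -(leq_pmul2r (_ : 0 < m - j)); last lia.
rewrite mulnAC eq1 -mulnA [h * _]mulnC -mulnA leq_mul2l; apply/orP; right.
by rewrite mulnBl mulnBr leq_sub2l // [h * j]mulnC leq_mul2l hm orbT.
Qed.

Lemma deg_setU1_ge I v : v \notin I -> allowed (v |: I) ->
  deg I <= deg (v |: I) * n (tag v).
Proof.
move=> vI avI; have := deg_setU1_eq vI avI.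
have := forallP avI (tag v); rewrite sz_setU1 // eqxx add1n.
set m := n _; set j := sz _ _; set h := k _; nia.
Qed.

(** Union bound: a set containing [I] either avoids [U] or contains some [u] in [U]. *)
Lemma deg_le_cnt_add I U : deg I <= cnt I U + \sum_(u in U) deg (u |: I).
Proof.
set Q := [set A in prodfam | (I \subset A) && [disjoint A & U]].
have -> : deg I = \sum_(A in prodfam | I \subset A) 1.
  by rewrite degE -sum1_card; apply: eq_bigl => A; rewrite inE.
have -> : cnt I U = \sum_(A in prodfam | I \subset A) [disjoint A & U].
  rewrite /cnt -sum1_card [in RHS](bigID (fun A => [disjoint A & U])) /=.
  rewrite [X in _ = _ + X]big1 ?addn0; last by move=> A /andP[_ /negPf ->].
  rewrite (eq_bigl (fun A => (A \in prodfam) && (I \subset A) && [disjoint A & U])).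
    by apply: eq_bigr => A /andP[_ ->].
  by move=> A; rewrite !inE andbA.
have -> : \sum_(u in U) deg (u |: I) =
    \sum_(u in U) \sum_(A in prodfam | I \subset A) (u \in A).
  apply: eq_bigr => u _; rewrite degE -sum1_card [in RHS]big_mkcond.
  rewrite [LHS]big_mkcond; apply: eq_bigr => A _; rewrite inE subUset sub1set.
  by case: (A \in prodfam); case: (I \subset A); case: (u \in A).
rewrite exchange_big -big_split; apply: leq_sum => A _ /=.
case: (boolP [disjoint A & U]) => // /pred0Pn [u /= /andP[uA uU]].
by rewrite (bigD1 u) //= uA.
Qed.

(** Extend [Y] to a member of the product that avoids [x], then keep only its parts in [W]. *)
Lemma fill Y x (W : {set 'I_p}) :
  allowed Y -> x \notin Y -> (forall s, k s < n s) ->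
  (forall v, v \in Y -> tag v \in W) ->
  exists2 Z : {set G}, Y \subset Z & x \notin Z /\ (forall s, sz Z s = if s \in W then k s else 0).
Proof.
move=> aY xY kn YW.
have [||A /prodfamP hA /andP[YA dA]] := extend (U := [set x]) aY.
- by rewrite disjoint_sym disjoints1.
- by move=> s; rewrite sz_set1; have := kn s; case: eqP; lia.
rewrite disjoint_sym disjoints1 in dA.
exists (A :&: [set v | tag v \in W]).
  by apply/subsetP => v vY; rewrite !inE (subsetP YA) ?YW.
split=> [|s]; first by rewrite !inE (negPf dA).
rewrite -hA; case: ifP => sW.
  apply: eq_card => v; rewrite !inE; case: (v \in A) => //=.
  by case: eqP => [->|]; rewrite ?sW ?andbF.
apply: eq_card0 => v; rewrite !inE; apply/negP => /andP[/andP[_ vW] /eqP vs].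
by rewrite vs sW in vW.
Qed.

(** The sets through [a] and [b] lie in the Hilton-Milner family with centre [a] and a full leaf set
    containing [b]. *)
Lemma deg_pair_le a b : (forall s, k s < n s) -> a != b -> allowed [set a; b] ->
  2 < \sum_s k s -> deg [set a; b] <= Mmax n k.
Proof.
move=> kn ab aab k3; set t := tag a.
(* At most one unit of the total of all [k s] is left outside [W], so a total above 2 provides at
   least two leaves. *)
pose W := [set s | (s != t) || (k s != 1)].
have [||v|Y bY [aY YW]] := @fill [set b] a W _ _ kn.
- exact: allowed1.
- by rewrite inE.
- rewrite !inE => /eqP ->; case: eqP => //= bt.
  have := forallP aab t; rewrite sz_setU1 ?inE // sz_set1 bt eqxx -/t; lia.
rewrite sub1set in bY.
apply: leq_trans (full_HM_le (x := a) (Y := Y) _).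
  rewrite degE; apply: subset_leq_card; apply/subsetP => A.
  rewrite !inE subUset !sub1set => /andP[-> /andP[-> bA]] /=.
  by apply/set0Pn; exists b; rewrite inE bA.
split=> //; last by exists W => //; rewrite inE eqxx.
rewrite (card_filled YW).
have : \sum_s k s = \sum_(s in W) k s + \sum_(s | s \notin W) k s by exact: bigID.
suff : \sum_(s | s \notin W) k s <= 1 /\ (k t != 1 -> 1 < \sum_(s in W) k s).
  case: (eqVneq (k t) 1) => kt [h1 h2] hk; last exact: h2.
  by rewrite hk in k3; rewrite -(ltn_add2r 1); apply: leq_trans k3 _; rewrite leq_add2l.
split=> [|kt]; last first.
  have tW : t \in W by rewrite inE kt orbT.
  by rewrite (bigD1 t) //= ltn_addr // ltn_neqAle eq_sym kt k_gt0.
case: (eqVneq (k t) 1) => kt; last first.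
  by rewrite big1 // => s; rewrite inE negb_or !negbK => /andP[/eqP -> /eqP]; lia.
rewrite (eq_bigl (pred1 t)) ?big_pred1_eq ?kt // => s.
by rewrite inE negb_or !negbK /=; case: eqP => // ->; rewrite kt.
Qed.

End Counting.

(** * Degrees and weights *)
Section Weights.
Import Order.TTheory GRing.Theory Num.Theory.
Local Open Scope ring_scope.
Variable R : realFieldType.
Variables (p : nat) (n k : 'I_p -> nat).
Local Notation G := (ground n).
Local Notation deg := (deg k).
Local Notation cnt := (cnt k).
Local Notation prodfam := (prodfam n k).
Local Notation allowed := (allowed k).
Implicit Types (A B I U Y : {set G}) (s : 'I_p) (a b c u v x y : G).

Local Notation K := (\sum_s k s)%N.
Local Notation kap := (K%:R : R).
Hypothesis k_gt0 : forall s, (0 < k s)%N.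
Hypothesis n_large : forall s, (100 * K ^ 12 <= n s)%N.

Definition w v : R := (n (tag v))%:R^-1.
Definition N : R := #|prodfam|%:R.

Lemma k_le_K s : (k s <= K)%N.
Proof. by rewrite (bigD1 s) //= leq_addr. Qed.

Lemma K_pos s : (0 < K)%N.
Proof. exact: leq_trans (k_gt0 s) (k_le_K s). Qed.

Lemma K_le_pow s i : (0 < i)%N -> (K <= K ^ i)%N.
Proof. by case: i => // i _; rewrite expnS leq_pmulr // expn_gt0 (K_pos s). Qed.

Lemma k_small s : (4 * k s < n s)%N.
Proof.
have := n_large s; have := K_le_pow s (isT : (0 < 12)%N); have := k_le_K s.
have := K_pos s; lia.
Qed.

Lemma k_le_n s : (k s <= n s)%N. Proof. have := k_small s; lia. Qed.
Lemma k_lt_n s : (k s < n s)%N. Proof. have := k_small s; lia. Qed.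

Lemma n_pos s : 0 < (n s)%:R :> R.
Proof. by rewrite ltr0n; have := k_small s; lia. Qed.

Lemma w_gt0 v : 0 < w v. Proof. by rewrite invr_gt0 n_pos. Qed.

Lemma kap_ge1 v : 1 <= kap. Proof. by rewrite ler1n (K_pos (tag v)). Qed.

(** One weight absorbs any constant power of [kap] that the branching costs, up to the twelfth, with
    a factor 100 to spare. *)
Lemma w_small i v : (i <= 12)%N -> 100 * kap ^+ i * w v <= 1.
Proof.
move=> i12; rewrite -[leLHS]/(_ / (n (tag v))%:R) (ler_pdivrMr _ _ (n_pos _)) mul1r.
apply: le_trans (_ : 100 * kap ^+ 12 <= _).
  by apply: ler_wpM2l => //; apply: ler_weXn2l => //; apply: kap_ge1 v.
by rewrite -natrX -(natrM _ 100) ler_nat n_large.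
Qed.

Lemma deg_set0 : (deg (set0 : {set G}))%:R = N.
Proof. by rewrite /N degE; congr (_%:R); apply: eq_card => A; rewrite inE sub0set andbT. Qed.

Lemma N_gt0 : 0 < N.
Proof.
rewrite -deg_set0.
rewrite ltr0n deg_prod; last by apply/forallP => s; rewrite sz_set0.
by apply/prodn_gt0 => s; rewrite sz_set0 !subn0 bin_gt0 k_le_n.
Qed.

Lemma deg_add_le I v : v \notin I -> (deg (v |: I))%:R <= kap * w v * (deg I)%:R.
Proof.
move=> vI; rewrite mulrAC ler_pdivlMr ?n_pos // -!natrM ler_nat.
by apply: leq_trans (deg_setU1_le k_le_n vI) _; rewrite leq_mul2r k_le_K orbT.
Qed.

Lemma deg_add_ge I v : v \notin I -> allowed (v |: I) ->
  w v * (deg I)%:R <= (deg (v |: I))%:R.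
Proof.
move=> vI avI; rewrite mulrC ler_pdivrMr ?n_pos // -!natrM ler_nat.
exact: deg_setU1_ge.
Qed.

Lemma deg1_le a : (deg [set a])%:R <= kap * w a * N.
Proof. by rewrite -deg_set0 -[[set a]]setU0 deg_add_le // inE. Qed.

Lemma deg2_le a b : a != b -> (deg [set a; b])%:R <= kap ^+ 2 * (w a * w b) * N.
Proof.
move=> ab; apply: le_trans (deg_add_le _) _; first by rewrite inE.
have -> : kap ^+ 2 * (w a * w b) * N = kap * w a * (kap * w b * N) by ring.
by rewrite ler_wpM2l ?deg1_le // mulr_ge0 // ltW // w_gt0.
Qed.

Lemma deg3_le a b c : a != b -> c != a -> c != b ->
  (deg (c |: [set a; b]))%:R <= kap ^+ 3 * (w a * w b * w c) * N.
Proof.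
move=> ab ca cb; apply: le_trans (deg_add_le _) _.
  by rewrite !inE negb_or ca cb.
have -> : kap ^+ 3 * (w a * w b * w c) * N = kap * w c * (kap ^+ 2 * (w a * w b) * N) by ring.
by rewrite ler_wpM2l ?deg2_le // mulr_ge0 // ltW // w_gt0.
Qed.

Lemma deg2_ge a b : a != b -> allowed [set a; b] ->
  w a * w b * N <= (deg [set a; b])%:R.
Proof.
move=> ab aab; apply: le_trans (deg_add_ge _ aab); last by rewrite inE.
rewrite -mulrA ler_wpM2l ?(ltW (w_gt0 _)) // -deg_set0 -[[set b]]setU0 deg_add_ge ?inE //.
by rewrite setU0 (allowed_subset _ aab) // subsetUr.
Qed.

(** Forbidding the few elements of [U] destroys at most half of the sets through [a] and [b]. *)
Lemma cnt2_ge a b U : a != b -> allowed [set a; b] -> a \notin U -> b \notin U ->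
  (#|U| <= K + 2)%N -> w a * w b * N <= 2 * (cnt [set a; b] U)%:R.
Proof.
move=> ab aab aU bU UK; apply: le_trans (deg2_ge ab aab) _.
set D := deg _; set C := cnt _ _.
have h1 : D%:R <= C%:R + \sum_(u in U) (deg (u |: [set a; b]))%:R :> R.
  by rewrite -natr_sum -natrD ler_nat deg_le_cnt_add.
(* The constant 6 is chosen because [#|U| <= K + 2 <= 3 * K]: the total loss is then at most half of
   [D]. *)
have h2 : \sum_(u in U) (deg (u |: [set a; b]))%:R <= #|U|%:R * (6 ^-1 / kap * D%:R) :> R.
  rewrite -sum1_card natr_sum mulr_suml; apply: ler_sum => u uU.
  have k1 := kap_ge1 u.
  apply: le_trans (deg_add_le _) _.
    rewrite !inE negb_or; apply/andP; split; apply: contraTneq uU => ->; done.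
  rewrite mul1r ler_wpM2r // ler_pdivlMr; last lra.
  have := w_small u (isT : (2 <= 12)%N); have := w_gt0 u; lra.
have k1 := kap_ge1 a.
suff : #|U|%:R * (6^-1 / kap * D%:R) <= 2^-1 * D%:R :> R by lra.
rewrite mulrA ler_wpM2r // mulrA ler_pdivrMr; last lra.
have : #|U|%:R <= kap + 2 :> R by rewrite -natrD ler_nat.
lra.
Qed.

Lemma pair_le a b : a != b -> allowed [set a; b] -> (2 < K)%N ->
  w a * w b * N <= (Mmax n k)%:R.
Proof.
move=> ab aab K2; apply: le_trans (deg2_ge ab aab) _.
by rewrite ler_nat deg_pair_le // => s; rewrite k_lt_n.
Qed.

Lemma allowed_card A : allowed A -> (#|A| <= K)%N.
Proof. by move=> /forallP hA; rewrite card_sz; apply: leq_sum. Qed.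

(** One branching round: every member of [Q] contains one of the at most [K] elements of [B], so a
    bound per element costs a factor [kap]. *)
Lemma hitting_bound (Q : {set {set G}}) B (beta : R) :
  (forall A, A \in Q -> ~~ [disjoint A & B]) -> (#|B| <= K)%N -> 0 <= beta ->
  (forall b, b \in B -> #|[set A in Q | b \in A]|%:R <= beta) ->
  #|Q|%:R <= kap * beta.
Proof.
move=> hit BK beta0 hb.
have h1 : (#|Q| <= \sum_(b in B) #|[set A in Q | b \in A]|)%N.
  have -> : (\sum_(b in B) #|[set A in Q | b \in A]| = \sum_(A in Q) #|A :&: B|)%N.
    transitivity (\sum_(b in B) \sum_(A in Q) (b \in A))%N.
      apply: eq_bigr => b _; rewrite -sum1_card [in RHS]big_mkcond [LHS]big_mkcond.
      by apply: eq_bigr => A _; rewrite inE; case: (A \in Q); case: (b \in A).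
    rewrite exchange_big; apply: eq_bigr => A _; rewrite -sum1_card.
    rewrite [in RHS]big_mkcond [LHS]big_mkcond.
    by apply: eq_bigr => b _; rewrite inE; case: (b \in A); case: (b \in B).
  rewrite -sum1_card; apply: leq_sum => A /hit.
  by rewrite -setI_eq0 -card_gt0.
have h2 : (\sum_(b in B) #|[set A in Q | b \in A]|)%:R <= #|B|%:R * beta.
  by rewrite natr_sum -sum1_card natr_sum mulr_suml; apply: ler_sum => b /hb; rewrite mul1r.
apply: le_trans (_ : #|B|%:R * beta <= _); last by rewrite ler_wpM2r // ler_nat.
by apply: le_trans h2; rewrite ler_nat.
Qed.

Definition M : R := (Mmax n k)%:R.

Lemma M_ge0 : 0 <= M. Proof. exact: ler0n. Qed.

(** The pair [a], [b] is charged to [M] through [pair_le], and the third element contributes its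
    weight. The set [A] makes the pair allowed and shows that [K] exceeds 2. *)
Lemma deg3_pair A a b c : allowed A -> a \in A -> b \in A -> c \in A ->
  a != b -> c != a -> c != b -> (deg (c |: [set a; b]))%:R <= kap ^+ 3 * w c * M.
Proof.
move=> aA aA1 bA cA ab ca cb; apply: le_trans (deg3_le ab ca cb) _.
have sub2 : [set a; b] \subset A by rewrite subUset !sub1set aA1.
have sub3 : c |: [set a; b] \subset A by rewrite subUset sub1set cA.
have K2 : (2 < K)%N.
  apply: leq_trans (allowed_card aA); apply: leq_trans (subset_leq_card sub3).
  by rewrite cardsU1 !inE negb_or ca cb cards2 ab.
have := pair_le ab (allowed_subset sub2 aA) K2.
have -> : kap ^+ 3 * (w a * w b * w c) * N = kap ^+ 3 * w c * (w a * w b * N) by ring.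
by apply: ler_wpM2l; rewrite mulr_ge0 ?exprn_ge0 // ltW // w_gt0.
Qed.

(** The exponent 9 is what remains of 12 after the [kap ^+ 3] of a triple; three branching rounds
    still leave [kap ^+ 3 * eps] at most 1/100. *)
Definition eps : R := (100 * kap ^+ 9)^-1.

Lemma eps_ge0 : 0 <= eps.
Proof. by rewrite invr_ge0; apply: mulr_ge0; [|apply: exprn_ge0]. Qed.

Lemma w_eps v : kap ^+ 3 * w v <= eps.
Proof.
have k1 := kap_ge1 v.
have k9 : 0 < 100 * kap ^+ 9 by apply: mulr_gt0; [|apply: exprn_gt0]; lra.
rewrite -[eps]mul1r (ler_pdivlMr _ _ k9).
have -> : kap ^+ 3 * w v * (100 * kap ^+ 9) = 100 * kap ^+ 12 * w v by ring.
exact: w_small.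
Qed.

Lemma kap_eps v : 100 * (kap ^+ 3 * eps) <= 1.
Proof.
have k1 := kap_ge1 v.
have k9 : 0 < 100 * kap ^+ 9 by apply: mulr_gt0; [|apply: exprn_gt0]; lra.
rewrite mulrA (ler_pdivrMr _ _ k9) mul1r.
by apply: ler_wpM2l => //; apply: ler_weXn2l.
Qed.

Lemma deg3_small A a b c : allowed A -> a \in A -> b \in A -> c \in A ->
  a != b -> c != a -> c != b -> (deg (c |: [set a; b]))%:R <= M * eps.
Proof.
move=> aA aA1 bA cA ab ca cb; apply: le_trans (deg3_pair aA aA1 bA cA ab ca cb) _.
by rewrite mulrC; apply: ler_wpM2l; [apply: M_ge0 | apply: w_eps].
Qed.

Lemma le_w a b : (n (tag a) <= n (tag b))%N -> w b <= w a.
Proof. by move=> nab; rewrite lef_pV2 ?ler_nat // posrE n_pos. Qed.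

Lemma allowed_pair A a b : allowed A -> a \in A -> b \in A -> allowed [set a; b].
Proof. by move=> aA aA1 bA; apply: allowed_subset aA; rewrite subUset !sub1set aA1. Qed.

Lemma allowed_pair_same a b : a != b -> allowed [set a; b] -> tag b = tag a ->
  (1 < k (tag a))%N.
Proof.
move=> ab aab ba; have := forallP aab (tag a).
by rewrite sz_setU1 ?inE // sz_set1 ba !eqxx.
Qed.

Lemma allowed_pairI a b : (tag b = tag a -> (1 < k (tag a))%N) -> allowed [set a; b].
Proof.
move=> hab; apply/forallP => s; have [->|ab] := eqVneq a b.
  by rewrite setUid (forallP (allowed1 _ _)).
rewrite sz_setU1 ?inE // sz_set1; have := k_gt0 s.
by case: eqP => [as_|_]; case: eqP => [bs|_]; rewrite ?as_ ?bs // => _;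
  rewrite -as_; apply: hab; rewrite as_ bs.
Qed.

Lemma sz_pair a b s : a != b -> sz [set a; b] s = ((tag a == s) + (tag b == s))%N.
Proof. by move=> ab; rewrite sz_setU1 ?inE // sz_set1. Qed.

(** * Maximal intersecting families exceeding the bound *)
Section MaximalFamily.
Variable F : {set {set G}}.
Hypothesis p_gt0 : (0 < p)%N.
Hypothesis F_sub : forall A, A \in F -> A \in prodfam.
Hypothesis F_int : forall A B, A \in F -> B \in F -> ~~ [disjoint A & B].
Hypothesis F_max : forall A, A \in prodfam ->
  (forall B, B \in F -> ~~ [disjoint A & B]) -> A \in F.
Hypothesis F_nt : forall x, exists2 A, A \in F & x \notin A.
Hypothesis F_big : (Mmax n k < #|F|)%N.

Definition transversal (T : {set G}) :=
  allowed T && [forall A in F, ~~ [disjoint T & A]].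

Lemma F_allowed A : A \in F -> allowed A.
Proof. by move=> /F_sub /prodfam_allowed. Qed.

Lemma F_card A : A \in F -> (#|A| <= K)%N.
Proof. by move=> /F_allowed /allowed_card. Qed.

Lemma M_lt_F : M < #|F|%:R. Proof. by rewrite ltr_nat. Qed.

Lemma tr_hit T A : transversal T -> A \in F -> ~~ [disjoint T & A].
Proof. by case/andP => _ /forall_inP; apply. Qed.

Lemma not_trP T : allowed T -> ~~ transversal T -> exists2 A, A \in F & [disjoint T & A].
Proof.
move=> aT; rewrite /transversal aT /= negb_forall_in => /exists_inP[A AF].
by rewrite negbK; exists A.
Qed.

(** If [T1] and [T2] were disjoint, [T1] would extend to a product set avoiding [T2]. That set meets
    every member because [T1] does, so by maximality it is a member itself, and [T2] misses it. *)
Lemma tr_meet T1 T2 : transversal T1 -> transversal T2 -> ~~ [disjoint T1 & T2].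
Proof.
move=> t1 t2; apply/negP => d12; have [a1 _] := andP t1; have [a2 _] := andP t2.
have [|A AP /andP[TA dA]] := extend a1 d12.
  by move=> s; have := k_small s; have := forallP a2 s; lia.
have AF : A \in F.
  apply: F_max => // B /(tr_hit t1); apply: contra => dAB.
  exact: disjointWl TA dAB.
by have := tr_hit t2 AF; rewrite disjoint_sym dA.
Qed.

(** Two branching rounds from the fixed element [y0]: first over [A0], which gives [b], then over a
    member [A1] missed by the pair, which gives a third element [c]. What remains is the degree of a
    triple. *)
Lemma two_step (Q : {set {set G}}) y0 A0 (beta : R) :
  Q \subset F -> (forall A, A \in Q -> y0 \in A) -> A0 \in F -> y0 \notin A0 ->
  0 <= beta ->
  (forall A b, A \in Q -> b \in A -> b \in A0 -> b != y0 ->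
     exists2 A1, A1 \in F & [disjoint [set y0; b] & A1] /\
       forall B c, B \in Q -> b \in B -> c \in B -> c \in A1 -> c != y0 -> c != b ->
         (deg (c |: [set y0; b]))%:R <= beta) ->
  #|Q|%:R <= kap ^+ 2 * beta.
Proof.
move=> QF Qy A0F yA0 beta0 step.
have QF' A : A \in Q -> A \in F by apply: (subsetP QF).
rewrite exprS expr1 -mulrA; apply: (@hitting_bound Q A0).
- by move=> A /QF' AF; apply: F_int.
- exact: F_card.
- by rewrite mulr_ge0.
move=> b bA0; have by0 : b != y0 by apply: contraNneq yA0 => <-.
case: (set_0Vmem [set A in Q | b \in A]) => [->|[A]].
  by rewrite cards0 mulr_ge0.
rewrite inE => /andP[AQ bA]; have [A1 A1F [dA1 hc]] := step A b AQ bA bA0 by0.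
apply: (@hitting_bound _ A1) => //.
- by move=> B; rewrite inE => /andP[/QF' BF _]; apply: F_int.
- exact: F_card.
move=> c cA1; case: (set_0Vmem [set B in [set A in Q | b \in A] | c \in B]) => [->|[B]].
  by rewrite cards0.
rewrite !inE => /andP[/andP[BQ bB] cB].
have cd : c \notin [set y0; b].
  by rewrite disjoint_sym disjoint_subset in dA1; have := subsetP dA1 c cA1; rewrite inE.
move: cd; rewrite !inE negb_or => /andP[cy cb].
apply: le_trans (hc B c BQ bB cB cA1 cy cb).
rewrite ler_nat degE; apply: subset_leq_card; apply/subsetP => C.
rewrite !inE => /andP[/andP[CQ bC] cC].
rewrite !subUset !sub1set cC bC (Qy _ CQ) !andbT.
by have := F_sub (QF' _ CQ); rewrite inE.
Qed.

Lemma F_nonempty : exists A, A \in F.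
Proof.
have s := Ordinal p_gt0; have ns : (0 < n s)%N by have := k_small s; lia.
by have [A AF _] := F_nt (Tagged (fun s => 'I_(n s)) (Ordinal ns)); exists A.
Qed.

Lemma kap_ge1_of_parts : 1 <= kap.
Proof. by rewrite ler1n; apply: K_pos (Ordinal p_gt0). Qed.

(** If no pair were transversal, three rounds would always lead to triples, giving
    [#|F| <= kap ^+ 3 * (M * eps) <= M]. The first pair is reached because no single element lies in
    all of [F]. *)
Lemma edge_exists : exists a b, a != b /\ transversal [set a; b].
Proof.
suff /existsP[a /existsP[b /andP[]]] :
    [exists a, exists b, (a != b) && transversal [set a; b]] by exists a, b.
apply: contraT => /existsPn noedge; have k1 := kap_ge1_of_parts.
have notr A a b : A \in F -> a \in A -> b \in A -> a != b ->
    exists2 B, B \in F & [disjoint [set a; b] & B].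
  move=> /F_allowed aA aA1 bA ab; apply: not_trP.
    by apply: allowed_subset aA; rewrite subUset !sub1set aA1.
  by have /existsPn/(_ b) := noedge a; rewrite ab.
have beta0 : 0 <= M * eps by apply: mulr_ge0; [apply: M_ge0 | apply: eps_ge0].
have [A0 A0F] := F_nonempty; have [a0 a0A0] : exists a, a \in A0.
  by apply/set0Pn; have := F_int A0F A0F; rewrite -setI_eq0 setIid.
suff : #|F|%:R <= kap * (kap ^+ 2 * (M * eps)).
  have -> : kap * (kap ^+ 2 * (M * eps)) = M * (kap ^+ 3 * eps) by ring.
  have h1 : kap ^+ 3 * eps <= 1 by have := kap_eps a0; lra.
  move=> h2; have := M_lt_F; have := ler_wpM2l M_ge0 h1; lra.
apply: (@hitting_bound _ A0).
- by move=> A AF; apply: F_int.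
- exact: F_card.
- by rewrite mulr_ge0 // exprn_ge0.
move=> a aA0; have [A1 A1F aA1] := F_nt a.
apply: (@two_step _ a A1) => //.
- by apply/subsetP => A; rewrite inE => /andP[].
- by move=> A; rewrite inE => /andP[].
move=> A b; rewrite inE => /andP[AF aA] bA bA1 ba.
have ab : a != b by rewrite eq_sym.
have [B BF dB] := notr A a b AF aA bA ab.
exists B => //; split=> // C c; rewrite inE => /andP[CF aC] bC cC cB ca cb.
by apply: (deg3_small (F_allowed CF)).
Qed.

(** * Splitting the family relative to a centre and a leaf set *)

Section Centre.
Variable x : G.

Definition hitF Y := [set A in F | (x \in A) && (A :&: Y != set0)].
Definition missF Y := [set A in F | (x \in A) && (A :&: Y == set0)].
Definition avoidF := [set A in F | x \notin A].

Lemma card_F_split Y : #|F| = (#|hitF Y| + (#|missF Y| + #|avoidF|))%N.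
Proof.
rewrite -!sum1_card (bigID (fun A => x \in A)) /=.
rewrite (bigID (fun A => A :&: Y != set0)) /= -addnA.
congr (_ + (_ + _))%N; apply: eq_bigl => A; rewrite !inE ?andbA //.
by rewrite negbK.
Qed.

(** Both kinds of sets lie in [HM x Z], and they are told apart by whether they meet [Y]. As [#|F|]
    exceeds the maximum, the gain [cnt [set x; y] Y] must be smaller than what [F] has outside
    [hitF Y]. *)
Lemma HM_gain Y Z y : full k x Z -> Y \subset Z -> y \in Z -> y \notin Y ->
  (#|hitF Y| + cnt [set x; y] Y <= Mmax n k)%N.
Proof.
move=> fZ YZ yZ yY; apply: leq_trans (full_HM_le k_gt0 fZ).
rewrite -cardsUI [X in (_ + X)%N](_ : _ = 0%N); last first.
  apply: eq_card0 => A; rewrite !inE; apply/negP.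
  move=> /andP[/andP[_ /andP[_ /set0Pn[u]]]]; rewrite inE => /andP[uA uY].
  case/and3P => _ _; rewrite disjoint_subset => /subsetP/(_ u uA).
  by rewrite inE uY.
rewrite addn0; apply: subset_leq_card; apply/subsetP => A; rewrite in_setU.
case/orP; rewrite inE => /and3P[AF].
  move=> xA /set0Pn[u]; rewrite inE => /andP[uA uY].
  rewrite inE F_sub //= xA; apply/set0Pn; exists u.
  by rewrite inE uA (subsetP YZ).
rewrite subUset !sub1set => /andP[xA yA] _; rewrite inE AF /= xA.
by apply/set0Pn; exists y; rewrite inE yA.
Qed.

Lemma hitF_le Y r : x \notin Y -> (#|Y| <= K)%N -> (forall y, y \in Y -> w y <= w r) ->
  #|hitF Y|%:R <= kap ^+ 3 * (w x * w r * N).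
Proof.
move=> xY YK hr; rewrite exprS -mulrA; apply: (@hitting_bound _ Y) => //.
- by move=> A; rewrite inE -setI_eq0 => /and3P[].
- by rewrite !mulr_ge0 ?exprn_ge0 // ltW // ?w_gt0 // N_gt0.
move=> b bY; have xb : x != b by apply: contraNneq xY => ->.
apply: le_trans (_ : (deg [set x; b])%:R <= _).
  rewrite ler_nat degE; apply: subset_leq_card; apply/subsetP => A.
  rewrite !inE subUset !sub1set => /andP[/and3P[AF -> _] ->]; rewrite !andbT.
  by have := F_sub AF; rewrite inE.
apply: le_trans (deg2_le xb) _; rewrite -mulrA ler_wpM2l ?exprn_ge0 //.
by rewrite ler_wpM2r ?(ltW N_gt0) // ler_wpM2l ?hr // ltW // w_gt0.
Qed.

(** A converse to [pair_le], up to a constant: if little lies outside [hitF x Y], the sets meeting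
    [Y] account for most of [M], and [r] bounds the weight of every leaf. *)
Lemma M_le_edge Y r : x \notin Y -> (#|Y| <= K)%N -> (forall y, y \in Y -> w y <= w r) ->
  (#|missF Y| + #|avoidF|)%:R <= 2 * (kap ^+ 2 * (M * eps)) ->
  M <= 2 * kap ^+ 3 * (w x * w r * N).
Proof.
move=> xY YK hr hres; have := hitF_le xY YK hr.
have := M_lt_F; rewrite (card_F_split Y) natrD => h1 h2.
have k1 := kap_ge1_of_parts; have e0 := eps_ge0.
have h3 : kap ^+ 2 * eps <= 100^-1.
  have := kap_eps x; have : kap ^+ 2 * eps <= kap ^+ 3 * eps.
    by rewrite ler_wpM2r // ler_weXn2l.
  lra.
have h4 : kap ^+ 2 * (M * eps) <= 100^-1 * M.
  have -> : kap ^+ 2 * (M * eps) = kap ^+ 2 * eps * M by ring.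
  by apply: ler_wpM2r h3; apply: M_ge0.
have := ler0n R #|hitF Y|; lra.
Qed.

End Centre.

(** * Stars *)
Section Star.
Variables (x y0 : G).
Hypothesis star : forall a b, a != b -> transversal [set a; b] -> (a == x) || (b == x).
Hypotheses (y0x : y0 != x) (try0 : transversal [set x; y0]).

Definition leaves := [set y | (y != x) && transversal [set x; y]].
Local Notation Y := leaves.

Lemma y0_leaf : y0 \in Y. Proof. by rewrite inE y0x. Qed.

Lemma x_notin_leaves : x \notin Y. Proof. by rewrite inE eqxx. Qed.

Lemma leaves_subset A : A \in F -> x \notin A -> Y \subset A.
Proof.
move=> AF xA; apply/subsetP => y; rewrite inE => /andP[_ /tr_hit/(_ AF)].
apply: contraNT => yA; rewrite disjoints_subset subUset !sub1set !inE.
by rewrite xA.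
Qed.

Lemma leaves_allowed : allowed Y.
Proof.
by have [A AF xA] := F_nt x; apply: allowed_subset (leaves_subset AF xA) (F_allowed AF).
Qed.

Lemma leaf_tag y : y \in Y -> tag y = tag x -> (1 < k (tag x))%N.
Proof.
rewrite inE eq_sym => /andP[xy /andP[a _]]; exact: allowed_pair_same xy a.
Qed.

(** The heaviest leaf is one in a smallest part. *)
Lemma best_leaf : exists2 r, r \in Y & forall y, y \in Y -> w y <= w r.
Proof.
case: (arg_minnP (fun y : G => n (tag y)) y0_leaf) => i iY hi.
by exists i => // y yY; apply: le_w; apply: hi.
Qed.

Section LeavesNotTransversal.
Hypothesis Y_not_tr : ~~ transversal Y.

(* When [k (tag x) = 1], no leaf can lie in the part of [x], which then counts as complete. *)
Definition open_part s := (sz Y s < k s)%N && ((s != tag x) || (k s != 1%N)).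

(** As [A] holds [Y] and also [b], the leaves do not exhaust the part of [b]. If [b] shares the part
    of [x], then [B] shows that this part takes two elements. *)
Lemma open_partI A B b : allowed A -> Y \subset A -> b \in A -> b \notin Y ->
  allowed B -> x \in B -> b \in B -> b != x -> open_part (tag b).
Proof.
move=> aA YA bA bY aB xB bB bx; apply/andP; split.
  apply: leq_trans (forallP aA (tag b)).
  have := sz_setU1 (tag b) bY; rewrite eqxx add1n => <-.
  by apply: sz_subset; rewrite subUset sub1set bA.
case: (eqVneq (tag b) (tag x)) => //= bx'; rewrite bx'.
have xb : x != b by rewrite eq_sym.
by rewrite neq_ltn (allowed_pair_same xb (allowed_pair aB xB bB) bx') orbT.
Qed.

(** Fill all parts that can take leaves. Branching away from [hitF x Y] passes through elements of
    open parts, none heavier than the new leaf [y], so the loss is a small multiple of the gain,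
    which is about [w x * w y * N]. *)
Lemma star_not_transversal : False.
Proof.
have [A0 A0F dA0] := not_trP leaves_allowed Y_not_tr.
(* A member without [x] would contain all leaves, whereas [A0] misses them. *)
have xA0 : x \in A0.
  apply: contraLR dA0 => xA0; rewrite -setI_eq0 (setIidPl (leaves_subset A0F xA0)).
  by apply/set0Pn; exists y0; apply: y0_leaf.
have notY b : b \in A0 -> b \notin Y.
  by move=> bA0; rewrite (disjointFl dA0 bA0).
have avoid_open A b : A \in F -> x \notin A -> b \in A -> b \in A0 -> open_part (tag b).
  move=> AF xA bA bA0; apply: (@open_partI A A0) => //; try exact: F_allowed.
  - exact: leaves_subset.
  - exact: notY.
  - by apply: contraNneq xA => <-.
have [A1 A1F xA1] := F_nt x.
have not_edge b : b != x -> b != y0 -> ~~ transversal [set y0; b].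
  move=> bx by0; apply/negP => /(star _); rewrite eq_sym by0 => /(_ isT).
  by rewrite (negPf y0x) (negPf bx).
have avoid_step A b : A \in F -> x \notin A -> b \in A -> b \in A0 ->
    b != y0 /\ exists2 B, B \in F & [disjoint [set y0; b] & B].
  move=> AF xA bA bA0.
  have by0 : b != y0 by apply: contraNneq (notY b bA0) => ->; apply: y0_leaf.
  have bx : b != x by apply: contraNneq xA => <-.
  split=> //; apply: not_trP (not_edge b bx by0).
  apply: (allowed_pair (F_allowed AF)) => //.
  exact: (subsetP (leaves_subset AF xA)) y0_leaf.
have [b0 b0A1 b0A0] : exists2 b, b \in A1 & b \in A0.
  by have /pred0Pn[b /andP[]] := F_int A1F A0F; exists b.
have K2 : (2 < K)%N.
  have [b0y0 [B BF dB]] := avoid_step A1 b0 A1F xA1 b0A1 b0A0.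
  have /pred0Pn[c /andP[/= cA1 cB]] := F_int A1F BF.
  apply: leq_trans (F_card A1F).
  have -> : (3 = #|c |: [set y0; b0]|)%N.
    by rewrite cardsU1 cards2 eq_sym b0y0 (disjointFl dB cB).
  apply: subset_leq_card; rewrite !subUset !sub1set cA1 b0A1 andbT.
  exact: (subsetP (leaves_subset A1F xA1)) y0_leaf.
(* Taking a smallest open part makes its elements the heaviest among open parts. *)
case: (arg_minnP n (avoid_open A1 b0 A1F xA1 b0A1 b0A0)) => s s_open s_min.
pose W := [set s | (s != tag x) || (k s != 1%N)].
have [|Z YZ [xZ ZW]] := fill (W := W) leaves_allowed x_notin_leaves k_lt_n.
  move=> v vY; rewrite inE; case: eqP => //= vx; rewrite vx.
  by rewrite neq_ltn (leaf_tag vY vx) orbT.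
have [szs sW] := andP s_open.
have [y yZ [yY ys]] : exists2 y, y \in Z & y \notin Y /\ tag y = s.
  have : ~~ (Z :&: fiber n s \subset Y :&: fiber n s).
    apply: contraL szs => /subset_leq_card; rewrite -leqNgt.
    by apply: leq_trans; rewrite -/(sz Z s) ZW inE sW.
  case/subsetPn => y; rewrite 2!in_setI => /andP[yZ ys]; rewrite ys andbT => yY.
  by exists y => //; split=> //; apply/eqP; move: ys; rewrite inE.
have fZ : full k x Z.
  split=> //; last by exists W => //; rewrite inE eqxx.
  apply: leq_trans (_ : #|y |: [set y0]| <= _)%N.
    by rewrite cardsU1 cards1 inE; case: eqP yY => // ->; rewrite y0_leaf.
  by apply: subset_leq_card; rewrite subUset !sub1set yZ (subsetP YZ) ?y0_leaf.
have w_open b : open_part (tag b) -> w b <= w y.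
  by move=> bo; apply: le_w; rewrite ys; apply: s_min.
have xy : x != y by apply: contraNneq xZ => ->.
have axy : allowed [set x; y].
  apply: allowed_pairI => yx; move: sW; rewrite -ys yx eqxx /=.
  by rewrite ltn_neqAle eq_sym k_gt0 andbT.
have w0 v := w_gt0 v; have w0' v := ltW (w_gt0 v).
have N0 := N_gt0; have N0' := ltW N0; have M0 := M_ge0.
have k1 := kap_ge1_of_parts; have k0 : 0 <= kap by lra.
(* Bounds for the triples met in the two branchings: [beta1] for [x] with two open elements, [beta2]
   for a pair containing [y0], charged to [M], with one open element. *)
pose beta1 : R := kap ^+ 3 * (w x * w y * w y) * N.
pose beta2 : R := kap ^+ 3 * w y * M.
have b10 : 0 <= beta1 by rewrite /beta1 !mulr_ge0 ?exprn_ge0.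
have b20 : 0 <= beta2 by rewrite /beta2 !mulr_ge0 ?exprn_ge0.
have b12 : beta1 <= beta2.
  have := pair_le xy axy K2.
  have -> : beta1 = kap ^+ 3 * w y * (w x * w y * N) by rewrite /beta1; ring.
  by apply: ler_wpM2l; rewrite mulr_ge0 ?exprn_ge0.
have b2eps : beta2 <= M * eps.
  by rewrite /beta2 mulrC; apply: ler_wpM2l => //; apply: w_eps.
have miss_le : #|missF x Y|%:R <= kap ^+ 2 * beta1.
  apply: (@two_step _ x A1) => //.
  - by apply/subsetP => A; rewrite inE => /andP[].
  - by move=> A; rewrite inE => /and3P[].
  have miss_open A B b : A \in missF x Y -> B \in F -> b \in A -> b \in B ->
      x \notin B -> b != x -> b \notin Y /\ open_part (tag b).
    rewrite inE => /and3P[AF xA AY] BF bA bB xB bx.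
    have bY : b \notin Y.
      by apply: contraTN AY => bY; apply/set0Pn; exists b; rewrite inE bA.
    by split=> //; apply: (@open_partI B A) => //; try exact: F_allowed; apply: leaves_subset.
  move=> A b AQ bA bA1 bx.
  have [bY bo] := miss_open A A1 b AQ A1F bA bA1 xA1 bx.
  have [AF xA _] : [/\ A \in F, x \in A & A :&: Y == set0] by move: AQ; rewrite inE => /and3P[].
  have nt : ~~ transversal [set x; b] by move: bY; rewrite inE bx.
  have [A2 A2F dA2] := not_trP (allowed_pair (F_allowed AF) xA bA) nt.
  exists A2 => //; split=> // B c BQ bB cB cA2 cx cb.
  have xA2 : x \notin A2.
    by move: dA2; rewrite disjoints_subset subUset !sub1set !inE => /andP[].
  have [_ co] := miss_open B A2 c BQ A2F cB cA2 xA2 cx.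
  have xb : x != b by rewrite eq_sym.
  apply: le_trans (deg3_le xb cx cb) _; rewrite /beta1 ler_wpM2r //.
  rewrite ler_wpM2l ?exprn_ge0 // ler_pM ?mulr_ge0 ?w_open //.
  by rewrite ler_wpM2l // w_open.
have avoid_le : #|avoidF x|%:R <= kap ^+ 2 * beta2.
  apply: (@two_step _ y0 A0) => //.
  - by apply/subsetP => A; rewrite inE => /andP[].
  - move=> A; rewrite inE => /andP[AF xA].
    exact: (subsetP (leaves_subset AF xA)) y0_leaf.
  - by apply: contraL y0_leaf => /notY.
  move=> A b; rewrite inE => /andP[AF xA] bA bA0 by0.
  have [_ [B BF dB]] := avoid_step A b AF xA bA bA0.
  exists B => //; split=> // C c; rewrite inE => /andP[CF xC] bC cC cB cy0 cb.
  have y0C := subsetP (leaves_subset CF xC) _ y0_leaf.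
  have y0c : y0 != c by rewrite eq_sym.
  have bc : b != c by rewrite eq_sym.
  (* The triple is reordered because [deg3_pair] extracts the weight of the added element, and it is
     [b], not [c], that is known to be in an open part. *)
  have -> : c |: [set y0; b] = b |: [set y0; c] by rewrite setUCA [c |: [set b]]setUC setUCA.
  apply: le_trans (deg3_pair (F_allowed CF) y0C cC bC y0c by0 bc) _.
  rewrite /beta2 ler_wpM2r // ler_wpM2l ?exprn_ge0 // w_open //.
  exact: avoid_open AF xA bA bA0.
have [r rY hr] := best_leaf.
have Mr : M <= 2 * kap ^+ 3 * (w x * w r * N).
  apply: (M_le_edge x_notin_leaves (allowed_card leaves_allowed) hr).
  have k2 : 0 <= kap ^+ 2 by rewrite exprn_ge0.
  have h1 : kap ^+ 2 * beta1 <= kap ^+ 2 * (M * eps) by apply: ler_wpM2l => //; apply: le_trans b12 b2eps.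
  have h2 : kap ^+ 2 * beta2 <= kap ^+ 2 * (M * eps) by apply: ler_wpM2l.
  rewrite natrD; lra.
have gain := HM_gain fZ YZ yZ yY.
have Fs := card_F_split x Y.
have cnt_lt : (cnt [set x; y] Y < #|missF x Y| + #|avoidF x|)%N.
  by rewrite -(ltn_add2l #|hitF x Y|) -Fs; apply: leq_ltn_trans gain F_big.
have := cnt2_ge xy axy x_notin_leaves yY (leq_trans (allowed_card leaves_allowed) (leq_addr _ _)).
have : (cnt [set x; y] Y)%:R < kap ^+ 2 * beta1 + kap ^+ 2 * beta2.
  apply: lt_le_trans (lerD miss_le avoid_le); by rewrite -natrD ltr_nat.
move=> h1 h2; set t := w x * w y * N in h2.
have t0 : 0 < t by rewrite !mulr_gt0.
have h3 : kap ^+ 2 * beta1 <= 100^-1 * t.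
  have -> : kap ^+ 2 * beta1 = kap ^+ 5 * w y * t by rewrite /beta1 /t; ring.
  by rewrite ler_wpM2r ?(ltW t0) //; have := w_small y (isT : (5 <= 12)%N); lra.
(* Here [Mr] turns [M] back into [w x * w r * N], so that the spare factor [w r] can absorb
   [kap ^+ 8]. *)
have h4 : kap ^+ 2 * beta2 <= 2 * 100^-1 * t.
  apply: le_trans (_ : kap ^+ 2 * (kap ^+ 3 * w y * (2 * kap ^+ 3 * (w x * w r * N))) <= _).
    by rewrite ler_wpM2l ?exprn_ge0 // ler_wpM2l // mulr_ge0 ?exprn_ge0.
  have -> : kap ^+ 2 * (kap ^+ 3 * w y * (2 * kap ^+ 3 * (w x * w r * N))) =
    2 * (kap ^+ 8 * w r) * t by rewrite /t; ring.
  by rewrite ler_wpM2r ?(ltW t0) //; have := w_small r (isT : (8 <= 12)%N); lra.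
suff : t < t by rewrite ltxx.
lra.
Qed.

End LeavesNotTransversal.

(** A transversal consisting of one leaf contradicts non-triviality; one of two leaves would be an
    edge missing the centre. *)
Lemma card_leaves_gt2 : transversal Y -> (2 < #|Y|)%N.
Proof.
move=> trY; rewrite ltnNge; apply/negP => Y2.
have Y1 : (0 < #|Y|)%N by apply/card_gt0P; exists y0; apply: y0_leaf.
have /orP[/cards1P[a Ya]|/cards2P[a [b [ab Yab]]]] : (#|Y| == 1%N) || (#|Y| == 2%N).
  by case: #|Y| Y1 Y2 => [|[|[|]]].
- have [A AF aA] := F_nt a; have := tr_hit trY AF.
  by rewrite Ya disjoints1 aA.
- rewrite Yab in trY; have /orP[] := star ab trY => /eqP ex.
    by have := x_notin_leaves; rewrite Yab ex !inE eqxx.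
  by have := x_notin_leaves; rewrite Yab ex !inE eqxx orbT.
Qed.

(** Now no member through [x] misses [Y], and members avoiding [x] contain all of [Y]. The loss is
    therefore at most the degree of any three leaves, which is compared with the gain from one new
    leaf. *)
Lemma star_transversal : transversal Y -> False.
Proof.
move=> trY; have Y3 := card_leaves_gt2 trY.
have [r rY hr] := best_leaf.
have aY := leaves_allowed.
have two a : exists b c, [/\ b \in Y, c \in Y, b != c, b != a & c != a].
  have /card_gt1P[b [c []]] : (1 < #|Y :\ a|)%N.
    by rewrite (cardsD1 a) in Y3; case: (a \in Y) Y3 => // Y3; apply: ltn_trans Y3.
  by rewrite !in_setD1 => /andP[ba bY] /andP[ca cY] bc; exists b, c; split.
have [b [c [bY cY bc br cr]]] := two r.
have xY := x_notin_leaves.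
have K2 : (2 < K)%N by apply: leq_trans Y3 (allowed_card aY).
have miss0 : #|missF x Y| = 0%N.
  apply: eq_card0 => A; rewrite inE; apply/negP => /and3P[AF _].
  by rewrite setIC setI_eq0 (negPf (tr_hit trY AF)).
have avoid_le : (#|avoidF x| <= deg Y)%N.
  rewrite degE; apply: subset_leq_card; apply/subsetP => A; rewrite !inE.
  case/andP=> AF xA; rewrite leaves_subset // andbT.
  by have := F_sub AF; rewrite inE.
have deg_sub a1 a2 a3 : a1 \in Y -> a2 \in Y -> a3 \in Y ->
    (deg Y)%:R <= (deg (a3 |: [set a1; a2]))%:R :> R.
  move=> Y1' Y2' Y3'; rewrite ler_nat; apply: deg_subset.
  by rewrite !subUset !sub1set Y3' Y1'.
have k1 := kap_ge1_of_parts; have k0 : 0 <= kap by lra.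
have w0 v := w_gt0 v; have w0' v := ltW (w_gt0 v).
have N0 := N_gt0; have N0' := ltW N0; have M0 := M_ge0.
have rb : r != b by rewrite eq_sym.
have cb : c != b by rewrite eq_sym.
have Mr : M <= 2 * kap ^+ 3 * (w x * w r * N).
  apply: (M_le_edge xY (allowed_card aY) hr).
  rewrite miss0 add0n.
  have h1 : #|avoidF x|%:R <= (deg Y)%:R :> R by rewrite ler_nat.
  have h2 := le_trans (deg_sub _ _ _ rY bY cY) (deg3_small aY rY bY cY rb cr cb).
  have h3 : 0 <= M * eps by apply: mulr_ge0 => //; apply: eps_ge0.
  have h4 : 1 <= kap ^+ 2 by rewrite exprn_ege1.
  have := ler_wpM2r h3 h4; lra.
(* Besides the part of [x], only parts that already contain a leaf are filled, so a new leaf weighs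
   as much as [x] or as an existing leaf. *)
pose W := [set s | if s == tag x then k s != 1%N else [exists y in Y, tag y == s]].
have tW : (tag x \in W) = (k (tag x) != 1%N) by rewrite inE eqxx.
have [|Z YZ [xZ ZW]] := fill (W := W) aY xY k_lt_n.
  move=> v vY; rewrite inE; case: eqP => vx.
    by rewrite vx neq_ltn (leaf_tag vY vx) orbT.
  by apply/exists_inP; exists v.
have fZ : full k x Z.
  split=> //; last by exists W.
  by apply: leq_trans (subset_leq_card YZ); apply: ltnW.
(* If filling adds nothing, [F] already lies in a full Hilton-Milner family. *)
case: (boolP (Z \subset Y)) => [ZY|/subsetPn[y yZ yY]].
  have YeZ : Y = Z by apply/eqP; rewrite eqEsubset YZ.
  have : (#|F| <= Mmax n k)%N.
    apply: leq_trans (full_HM_le k_gt0 fZ); rewrite -YeZ.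
    apply: subset_leq_card; apply/subsetP => A AF; rewrite in_set F_sub //=.
    case: ifP => xA; last by rewrite leaves_subset // xA.
    by rewrite setIC setI_eq0 tr_hit.
  by rewrite leqNgt F_big.
have yW : tag y \in W.
  by have := sz_gt0 yZ; rewrite ZW; case: ifP.
have xy : x != y by apply: contraNneq xZ => ->.
have axy : allowed [set x; y].
  apply: allowed_pairI => yx; move: yW; rewrite yx tW.
  by rewrite ltn_neqAle eq_sym k_gt0 andbT.
have gain := HM_gain fZ YZ yZ yY.
have cnt_lt : (cnt [set x; y] Y < #|avoidF x|)%N.
  have Fs := card_F_split x Y; rewrite miss0 add0n in Fs.
  by rewrite -(ltn_add2l #|hitF x Y|) -Fs; apply: leq_ltn_trans gain F_big.
have lt2 : w x * w y * N < 2 * (deg Y)%:R.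
  apply: le_lt_trans (cnt2_ge xy axy xY yY (leq_trans (allowed_card aY) (leq_addr _ _))) _.
  by rewrite ltr_pM2l // ltr_nat; apply: leq_trans cnt_lt avoid_le.
set t := w x * w y * N in lt2.
have t0 : 0 < t by rewrite !mulr_gt0.
suff h : (deg Y)%:R <= 4 * 100^-1 * t.
  by suff : t < t; [rewrite ltxx | lra].
(* When [y] is in the part of [x], comparing [pair_le] for [r] and another leaf [v] with [Mr] gives
   [w v <= 2 * kap ^+ 3 * w x]. This applies to two leaves of the triple. *)
have [yx|yx] := eqVneq (tag y) (tag x).
  have wyx : w y = w x by rewrite /w yx.
  have w_le v : v \in Y -> v != r -> w v <= 2 * kap ^+ 3 * w x.
    move=> vY vr; have rv : r != v by rewrite eq_sym.
    have := le_trans (pair_le rv (allowed_pair aY rY vY) K2) Mr.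
    have -> : 2 * kap ^+ 3 * (w x * w r * N) = w r * N * (2 * kap ^+ 3 * w x) by ring.
    by rewrite mulrAC ler_pM2l // mulr_gt0.
  apply: le_trans (deg_sub _ _ _ rY bY cY) _.
  apply: le_trans (deg3_le rb cr cb) _.
  apply: le_trans (_ : kap ^+ 3 * (w r * ((2 * kap ^+ 3 * w x) * (2 * kap ^+ 3 * w x))) * N <= _).
    rewrite ler_wpM2r // ler_wpM2l ?exprn_ge0 // -mulrA ler_wpM2l //.
    by rewrite ler_pM // w_le.
  have -> : kap ^+ 3 * (w r * ((2 * kap ^+ 3 * w x) * (2 * kap ^+ 3 * w x))) * N
    = 4 * (kap ^+ 9 * w r) * t by rewrite /t wyx; ring.
  by rewrite ler_wpM2r ?(ltW t0) //; have := w_small r (isT : (9 <= 12)%N); lra.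
(* Otherwise some leaf [d] shares the part, hence the weight, of [y]; two further leaves are charged
   to [M]. *)
have /exists_inP[d dY /eqP dy] : [exists v in Y, tag v == tag y].
  by move: yW; rewrite inE (negPf yx).
have [a1 [a2 [a1Y a2Y a12 a1d a2d]]] := two d.
apply: le_trans (deg_sub _ _ _ a1Y a2Y dY) _.
have da1 : d != a1 by rewrite eq_sym.
have da2 : d != a2 by rewrite eq_sym.
apply: le_trans (deg3_pair aY a1Y a2Y dY a12 da1 da2) _.
have -> : w d = w y by rewrite /w dy.
apply: le_trans (_ : kap ^+ 3 * w y * (2 * kap ^+ 3 * (w x * w r * N)) <= _).
  by rewrite ler_wpM2l // mulr_ge0 ?exprn_ge0.
have -> : kap ^+ 3 * w y * (2 * kap ^+ 3 * (w x * w r * N)) =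
    2 * (kap ^+ 6 * w r) * t by rewrite /t; ring.
by rewrite ler_wpM2r ?(ltW t0) //; have := w_small r (isT : (6 <= 12)%N); lra.
Qed.

Lemma star_absurd : False.
Proof. by case: (boolP (transversal Y)) => [/star_transversal|/star_not_transversal]. Qed.

End Star.

(** * Triangles *)
Definition triangle x y z :=
  [/\ x != y, x != z & y != z] /\ [/\ transversal [set x; y], transversal [set x; z]
    & transversal [set y; z]].

Lemma triangle_swap x y z : triangle x y z -> triangle y x z.
Proof.
by case=> [[xy xz yz] [txy txz tyz]]; split; split; rewrite // 1?eq_sym // setUC.
Qed.

Lemma triangle_rot x y z : triangle x y z -> triangle y z x.
Proof.
case=> [[xy xz yz] [txy txz tyz]]; split; split; rewrite // 1?eq_sym //.
  by rewrite setUC.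
by rewrite setUC.
Qed.

Lemma pair_hit a b A : transversal [set a; b] -> A \in F -> a \notin A -> b \in A.
Proof.
move=> t AF aA; have := tr_hit t AF; apply: contraNT => bA.
by rewrite disjoints_subset subUset !sub1set !inE aA.
Qed.

Lemma triangle_subset x y z : triangle x y z -> F \subset HM k x [set y; z].
Proof.
case=> _ [txy txz tyz]; apply/subsetP => A AF; rewrite in_set F_sub //=.
case: ifP => [xA|/negbT xA].
  by rewrite setIC setI_eq0 tr_hit.
by rewrite subUset !sub1set (pair_hit txy) // (pair_hit txz).
Qed.

Lemma triangle_not_full x y z : triangle x y z -> ~ full k x [set y; z].
Proof.
move=> t fZ; have := leq_trans (subset_leq_card (triangle_subset t)) (full_HM_le k_gt0 fZ).
by rewrite leqNgt F_big.
Qed.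

(** Every member contains one of the three edges. *)
Lemma triangle_M_lt x y z : triangle x y z ->
  M < kap ^+ 2 * (w x * w y + w x * w z + w y * w z) * N.
Proof.
move=> t; have [[xy xz yz] _] := t; apply: lt_le_trans M_lt_F _.
have -> : kap ^+ 2 * (w x * w y + w x * w z + w y * w z) * N =
  kap ^+ 2 * (w x * w y) * N + kap ^+ 2 * (w x * w z) * N + kap ^+ 2 * (w y * w z) * N by ring.
apply: le_trans (lerD (lerD (deg2_le xy) (deg2_le xz)) (deg2_le yz)).
rewrite -!natrD ler_nat !degE.
apply: leq_trans (leq_add (leq_card_setU _ _) (leqnn _)).
apply: leq_trans (leq_card_setU _ _).
apply: subset_leq_card; apply/subsetP => A AF; have := subsetP (triangle_subset t) A AF.
rewrite !in_setU !in_set !subUset !sub1set => /andP[-> /=].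
case: ifP => [xA /set0Pn[v]|_ ->]; last by rewrite !orbT.
by rewrite !inE => /andP[vA /orP[] /eqP <-]; rewrite vA ?orbT.
Qed.

(** Take [x] as centre and add the leaf [u]. Only the members avoiding [x] can be lost, and they
    contain [y] and [z]. Those without [u] are outnumbered by the new sets [Cu], by the assumed
    comparison; those with [u] must be kept or replaced. *)
Lemma triangle_no_gain x y z u : triangle x y z ->
  u \notin [set x; y; z] -> tag u = tag y -> allowed (u |: [set y; z]) ->
  (cnt [set y; z] [set x; u] <= cnt [set x; u] [set y; z])%N -> False.
Proof.
move=> t uT uy aT cond; have [[xy xz yz] [txy txz tyz]] := t.
move: uT; rewrite !inE !negb_or -andbA => /and3P[ux uy' uz].
have [[axy _] [axz _]] := (andP txy, andP txz).
have uyz : u \notin [set y; z] by rewrite !inE negb_or uy'.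
have T3 : #|u |: [set y; z]| = 3%N by rewrite cardsU1 cards2 uyz yz.
have K2 : (2 < K)%N by rewrite -T3 allowed_card.
have xT : x \notin u |: [set y; z] by rewrite !inE !negb_or eq_sym ux xy.
pose W := [set s | [|| s == tag y, s == tag z | (s == tag x) && (k s != 1%N)]].
have tW : (tag x \in W) = (k (tag x) != 1%N).
  rewrite inE eqxx /=; case: eqVneq => [xy_|_].
    by rewrite neq_ltn (allowed_pair_same xy axy (esym xy_)) orbT.
  case: eqVneq => [xz_|_] //.
  by rewrite neq_ltn (allowed_pair_same xz axz (esym xz_)) orbT.
have [|Z TZ [xZ ZW]] := fill (W := W) aT xT k_lt_n.
  by move=> v; rewrite !inE => /or3P[] /eqP ->; rewrite ?uy eqxx ?orbT.
have fZ : full k x Z.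
  split=> //; last by exists W.
  by apply: leq_trans (subset_leq_card TZ); rewrite T3.
pose Y : {set G} := [set y; z].
have YZ : Y \subset Z by apply: subset_trans TZ; apply: subsetUr.
have uZ : u \in Z by apply: (subsetP TZ); rewrite !inE eqxx.
have miss0 : #|missF x Y| = 0%N.
  apply: eq_card0 => A; rewrite inE; apply/negP => /and3P[AF _].
  by rewrite setIC setI_eq0 (negPf (tr_hit tyz AF)).
pose Au := [set A in avoidF x | u \in A].
have avoid_sub A : A \in avoidF x -> [/\ A \in prodfam, x \notin A, y \in A & z \in A].
  rewrite inE => /andP[AF xA]; split=> //; first exact: F_sub.
    exact: pair_hit txy AF xA.
  exact: pair_hit txz AF xA.
have avoid_le : (#|avoidF x| <= cnt [set y; z] [set x; u] + #|Au|)%N.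
  rewrite -(cardsID [set A : {set G} | u \in A] (avoidF x)) addnC leq_add //.
    apply: subset_leq_card; apply/subsetP => A; rewrite in_setD => /andP[uA] /avoid_sub[AP xA yA zA].
    rewrite in_set AP subUset !sub1set yA zA /= disjoint_sym disjoints_subset.
    by rewrite subUset !sub1set !in_setC xA; move: uA; rewrite inE.
  by apply: subset_leq_card; apply/subsetP => A; rewrite !inE.
have Fs := card_F_split x Y; rewrite miss0 add0n in Fs.
pose Cu := [set A in prodfam | ([set x; u] \subset A) && [disjoint A & Y]].
(* [D] stands for whatever compensates the members counted by [Au]. *)
have gain (D : {set {set G}}) : (#|avoidF x| <= #|Cu| + #|D|)%N ->
    D \subset HM k x Z -> [disjoint hitF x Y :|: Cu & D] -> False.
  move=> hD DH dD.
  have : (#|F| <= Mmax n k)%N; last by rewrite leqNgt F_big.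
  apply: leq_trans (full_HM_le k_gt0 fZ); rewrite Fs.
  apply: leq_trans (leq_add (leqnn _) hD) _; rewrite addnA.
  have <- : #|hitF x Y :|: Cu| = (#|hitF x Y| + #|Cu|)%N.
    rewrite cardsU (_ : _ :&: _ = set0) ?cards0 ?subn0 //.
    apply/eqP; rewrite setI_eq0; apply/pred0P => A /=; rewrite !in_set -setI_eq0.
    by case: (_ == set0); rewrite /= ?andbF.
  have <- : #|(hitF x Y :|: Cu) :|: D| = (#|hitF x Y :|: Cu| + #|D|)%N.
    by rewrite cardsU (_ : _ :&: _ = set0) ?cards0 ?subn0 //; apply/eqP; rewrite setI_eq0.
  apply: subset_leq_card; rewrite !subUset DH andbT; apply/andP; split.
    apply/subsetP => A; rewrite in_set => /and3P[AF xA /set0Pn[v]].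
    rewrite in_setI => /andP[vA vY]; rewrite in_set F_sub //= xA.
    by apply/set0Pn; exists v; rewrite inE vA (subsetP YZ).
  apply/subsetP => A; rewrite in_set subUset !sub1set => /andP[AP /andP[/andP[xA uA] _]].
  by rewrite in_set AP xA; apply/set0Pn; exists u; rewrite inE uA.
have CuE : #|Cu| = cnt [set x; u] [set y; z] by [].
(* If [u], [y], [z] are all the leaves, the sets of [Au] remain in [HM x Z]. Otherwise a further
   leaf [v] brings in [Cv], which is shown to be at least as large as [Au]. *)
case: (boolP (Z \subset u |: Y)) => [ZT|/subsetPn[v vZ vT]].
  apply: (gain Au).
  - by apply: leq_trans avoid_le _; rewrite leq_add2r CuE.
  - apply/subsetP => A; rewrite in_set => /andP[/avoid_sub[AP xA yA zA] uA].
    rewrite in_set AP (negPf xA) /=; apply: subset_trans ZT _.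
    by rewrite !subUset !sub1set uA yA.
  - rewrite -setI_eq0; apply/eqP/setP => A; rewrite !inE.
    rewrite subUset !sub1set; case: (x \in A); by rewrite ?andbF.
pose Cv := [set A in prodfam | ([set x; v] \subset A) && [disjoint A & u |: Y]].
apply: (gain Cv); last first.
- rewrite disjoint_sym disjoints_subset; apply/subsetP => A.
  rewrite in_set => /andP[AP /andP[_ dA]]; rewrite in_setC in_setU negb_or.
  have uA : u \notin A by rewrite (disjointFl dA) // !inE eqxx.
  rewrite !in_set subUset !sub1set (negPf uA) andbF /= andbF andbT.
  have -> : A :&: Y = set0.
    apply/eqP; rewrite setI_eq0; apply: disjointWr dA; exact: subsetUr.
  by rewrite eqxx !andbF.
- apply/subsetP => A; rewrite in_set subUset !sub1set => /andP[AP /andP[/andP[xA vA] _]].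
  by rewrite in_set AP xA; apply/set0Pn; exists v; rewrite inE vA.
apply: leq_trans avoid_le _; apply: leq_add; first exact: cond.
have AuT : (#|Au| <= deg (u |: Y))%N.
  rewrite degE; apply: subset_leq_card; apply/subsetP => A.
  rewrite in_set => /andP[/avoid_sub[AP _ yA zA] uA].
  by rewrite in_set AP !subUset !sub1set uA yA.
apply: leq_trans AuT _; rewrite -(ler_nat R).
change #|Cv| with (cnt [set x; v] (u |: Y)).
have k1 := kap_ge1_of_parts; have k0 : 0 <= kap by lra.
have w0 a := w_gt0 a; have w0' a := ltW (w_gt0 a).
have N0 := N_gt0; have N0' := ltW N0.
have wu : w u = w y by rewrite /w uy.
have xu : x != u by rewrite eq_sym.
have yu : y != u by rewrite eq_sym.
(* The assumed comparison bounds the pair [y], [z] by the pair [x], [u]; since [u] and [y] weigh the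
   same, [w y] cancels. *)
have wzx : w z <= 2 * kap ^+ 2 * w x.
  have ayz := allowed_subset (subsetUr _ _) aT.
  have zxu : z \notin [set x; u] by rewrite !inE negb_or eq_sym xz eq_sym uz.
  have yxu : y \notin [set x; u] by rewrite !inE negb_or eq_sym xy eq_sym uy'.
  have U2 : (#|[set x; u]| <= K + 2)%N by rewrite cards2 xu leq_addl.
  have h1 := cnt2_ge yz ayz yxu zxu U2.
  have h2 : (cnt [set y; z] [set x; u])%:R <= (deg [set x; u])%:R :> R.
    by rewrite ler_nat; apply: leq_trans cond (cnt_le_deg _ _ _).
  have h3 := deg2_le xu.
  have : w y * N * w z <= w y * N * (2 * kap ^+ 2 * w x).
    have -> : w y * N * (2 * kap ^+ 2 * w x) = 2 * (kap ^+ 2 * (w x * w u) * N) by rewrite wu; ring.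
    have -> : w y * N * w z = w y * w z * N by ring.
    by apply: le_trans h1 _; rewrite ler_pM2l //; apply: le_trans h2 h3.
  by rewrite ler_pM2l // mulr_gt0.
pose e := kap ^+ 2 * w y + 2 * kap ^+ 4 * w y + kap ^+ 2 * w z.
(* The pair [y], [u] is bounded by [M], hence by the three edges of the triangle; [wzx] makes [w x]
   a factor of each term. *)
have wyy : w y * w y <= e * w x.
  have ayu : allowed [set y; u].
    by apply: allowed_pair aT _ _; rewrite !inE eqxx ?orbT.
  have h1 := le_lt_trans (pair_le yu ayu K2) (triangle_M_lt t).
  rewrite wu ltr_pM2r // in h1; apply: le_trans (ltW h1) _.
  have -> : e * w x = kap ^+ 2 * (w x * w y + w x * w z + w y * (2 * kap ^+ 2 * w x)) by rewrite /e; ring.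
  by rewrite ler_wpM2l ?exprn_ge0 // lerD2l ler_wpM2l.
have xv : x != v by apply: contraNneq xZ => ->.
have vW : tag v \in W by have := sz_gt0 vZ; rewrite ZW; case: ifP.
have axv : allowed [set x; v].
  apply: allowed_pairI => vx; move: vW; rewrite vx tW.
  by rewrite ltn_neqAle eq_sym k_gt0 andbT.
have U3 : (#|u |: Y| <= K + 2)%N by rewrite T3; apply: leq_trans K2 (leq_addr _ _).
have h := cnt2_ge xv axv xT vT U3.
suff : 2 * (deg (u |: Y))%:R <= w x * w v * N.
  by move=> h'; have := le_trans h' h; rewrite ler_pM2l.
apply: le_trans (_ : 2 * (kap ^+ 3 * (w y * w z * w y) * N) <= _).
  by rewrite ler_pM2l // -{2}wu; apply: deg3_le.
have e_small : kap ^+ 3 * e <= 4 * 100^-1.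
  have := w_small y (isT : (5 <= 12)%N); have := w_small y (isT : (7 <= 12)%N).
  have := w_small z (isT : (5 <= 12)%N).
  have -> : kap ^+ 3 * e = kap ^+ 5 * w y + 2 * (kap ^+ 7 * w y) + kap ^+ 5 * w z by rewrite /e; ring.
  lra.
have e_small' : kap ^+ 5 * e <= 4 * 100^-1.
  have := w_small y (isT : (7 <= 12)%N); have := w_small y (isT : (9 <= 12)%N).
  have := w_small z (isT : (7 <= 12)%N).
  have -> : kap ^+ 5 * e = kap ^+ 7 * w y + 2 * (kap ^+ 9 * w y) + kap ^+ 7 * w z by rewrite /e; ring.
  lra.
rewrite mulrA ler_pM2r //.
(* The product [w y * w z * w y] has to be small against [w x * w v]: use [wzx] if [v] is in the
   part of [y], [wyy] if in that of [z], and both if in that of [x]. *)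
move: vW; rewrite inE => /or3P[/eqP vy|/eqP vz|/andP[/eqP vx _]].
- have -> : w v = w y by rewrite /w vy.
  apply: le_trans (_ : 2 * (kap ^+ 3 * (w y * w y * (2 * kap ^+ 2 * w x))) <= _).
    rewrite ler_pM2l // ler_wpM2l ?exprn_ge0 // mulrAC ler_wpM2l // mulr_ge0 //.
  have -> : 2 * (kap ^+ 3 * (w y * w y * (2 * kap ^+ 2 * w x))) =
    4 * (kap ^+ 5 * w y) * (w x * w y) by ring.
  rewrite ler_piMl ?mulr_ge0 //; have := w_small y (isT : (5 <= 12)%N); lra.
- have -> : w v = w z by rewrite /w vz.
  apply: le_trans (_ : 2 * (kap ^+ 3 * (e * w x * w z)) <= _).
    by rewrite ler_pM2l // ler_wpM2l ?exprn_ge0 // mulrAC ler_wpM2r.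
  have -> : 2 * (kap ^+ 3 * (e * w x * w z)) = 2 * (kap ^+ 3 * e) * (w x * w z) by ring.
  rewrite ler_piMl ?mulr_ge0 //; lra.
- have -> : w v = w x by rewrite /w vx.
  apply: le_trans (_ : 2 * (kap ^+ 3 * (e * w x * (2 * kap ^+ 2 * w x))) <= _).
    rewrite ler_pM2l // ler_wpM2l ?exprn_ge0 // mulrAC ler_pM ?mulr_ge0 //.
  have -> : 2 * (kap ^+ 3 * (e * w x * (2 * kap ^+ 2 * w x))) =
    4 * (kap ^+ 5 * e) * (w x * w x) by ring.
  rewrite ler_piMl ?mulr_ge0 //; lra.
Qed.

(* As [u] and [y] lie in the same part, the comparison of counts required by [triangle_no_gain]
   for the centre [x] is the reverse of the one for the centre [z], so one of them holds. *)
Lemma triangle_no_room x y z : triangle x y z ->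
  (2 + (tag z == tag y) <= k (tag y))%N -> (2 + (tag x == tag y) <= k (tag y))%N -> False.
Proof.
move=> t roomz roomx; have [[xy xz yz] [txy txz tyz]] := t.
have [u uy uT] : exists2 u, tag u = tag y & u \notin [set x; y; z].
  have : ~~ (fiber n (tag y) \subset [set x; y; z]).
    apply/negP => /subset_leq_card; rewrite card_fiber leqNgt => /negP; apply.
    apply: leq_ltn_trans (_ : 4 * k (tag y) < _)%N; last exact: k_small.
    apply: leq_trans (_ : 3 <= _)%N; last by apply: (@leq_trans (4 * 1)); rewrite ?leq_mul2l ?k_gt0.
    by rewrite -setUA cardsU1 cards2; case: (_ \notin _); case: (_ != _).
  by case/subsetPn => u; rewrite inE => /eqP uy uT; exists u.
have uT' := uT; move: uT'; rewrite !inE !negb_or -andbA => /and3P[ux uy' uz].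
have alw v : y != v -> u != v -> (2 + (tag v == tag y) <= k (tag y))%N ->
    allowed (u |: [set y; v]).
  move=> yv uv room; apply/forallP => s.
  rewrite sz_setU1 ?sz_pair //; last by rewrite !inE negb_or uy'.
  rewrite uy; case: eqVneq => [<-|_]; first by rewrite addnA.
  by rewrite !add0n; apply: leq_trans (leq_b1 _) (k_gt0 s).
have yx : y != x by rewrite eq_sym.
have zy : z != y by rewrite eq_sym.
have xu : x != u by rewrite eq_sym.
have zu : z != u by rewrite eq_sym.
have dis a b c d : c != a -> c != b -> d != a -> d != b -> [disjoint [set a; b] & [set c; d]].
  move=> ca cb da db; rewrite disjoint_sym disjoints_subset subUset !sub1set !inE.
  by rewrite !negb_or ca cb da.
have [cond|cond] := leqP (cnt [set y; z] [set x; u]) (cnt [set x; u] [set y; z]).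
  exact: triangle_no_gain t uT uy (alw z yz uz roomz) cond.
have t' : triangle z y x by apply: triangle_swap; apply: triangle_rot.
apply: (triangle_no_gain t' _ uy (alw x yx ux roomx)).
  by rewrite !inE !negb_or uz uy' ux.
have [[ayx _] [ayz _]] := (andP txy, andP tyz).
have -> : cnt [set y; x] [set z; u] = cnt [set x; u] [set y; z].
  apply: cnt_sz; rewrite ?dis // 1?eq_sym //; first by rewrite setUC.
    by move=> s; rewrite !sz_pair // uy addnC.
  by move=> s; rewrite !sz_pair // uy addnC.
have -> : cnt [set z; u] [set y; x] = cnt [set y; z] [set x; u].
  apply/esym; apply: cnt_sz; rewrite ?dis // 1?eq_sym //.
    by move=> s; rewrite !sz_pair // uy addnC.
  by move=> s; rewrite !sz_pair // uy addnC.
exact: ltnW.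
Qed.

(** Unless some part has room for a further leaf, [k] is 2 on the part of [x] and [y] and 1 on that
    of [z]; then [[set x; y]] is a full leaf set for the centre [z]. *)
Lemma triangle_two_in_part x y z : triangle x y z -> tag x = tag y -> tag z != tag y -> False.
Proof.
move=> t xy zy; have [[nxy nxz nyz] [txy txz tyz]] := t; have [axy _] := andP txy.
have k2 := allowed_pair_same nxy axy (esym xy).
have zx : tag z != tag x by rewrite xy.
have [kz|kz] := ltnP 1 (k (tag z)).
  apply: (triangle_no_room (triangle_rot (triangle_swap t))); rewrite ?xy eq_sym (negPf zy) //.
have [kx|kx] := ltnP 2 (k (tag y)).
  by apply: (triangle_no_room t); rewrite ?(negPf zy) ?xy ?eqxx // ltnW.
apply: (triangle_not_full (triangle_rot (triangle_rot t))).
split; first by rewrite !inE negb_or eq_sym nxz eq_sym.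
  by rewrite cards2 nxy.
exists [set tag y].
  move=> s; rewrite sz_pair // xy inE eq_sym; case: eqP => [->|//].
  by apply/eqP; rewrite eqn_leq kx -xy k2.
by rewrite inE (negPf zy); apply/esym/negbF; rewrite eqn_leq kz k_gt0.
Qed.

(** Cases by which vertices share a part. Without room, either all three lie in one part with
    [k = 2], or in three parts with [k = 1], and [[set y; z]] is full for [x]; two sharing a part is
    treated above. *)
Lemma triangle_absurd x y z : ~ triangle x y z.
Proof.
move=> t; have [[nxy nxz nyz] [txy txz tyz]] := t; have [axy _] := andP txy.
have [xy|xy] := eqVneq (tag x) (tag y).
  have [zy|zy] := eqVneq (tag z) (tag y); last exact: triangle_two_in_part t xy zy.
  have k2 := allowed_pair_same nxy axy (esym xy).
  have [k3|k3] := ltnP 2 (k (tag y)).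
    by apply: (triangle_no_room t); rewrite ?xy ?zy eqxx.
  apply: (triangle_not_full t); split; first by rewrite !inE negb_or nxy.
    by rewrite cards2 nyz.
  exists [set tag x].
    move=> s; rewrite sz_pair // zy xy inE eq_sym; case: eqP => [->|//].
    by apply/eqP; rewrite eqn_leq k3 -xy k2.
  by rewrite inE eqxx neq_ltn k2 orbT.
have [xz|xz] := eqVneq (tag x) (tag z).
  by apply: (triangle_two_in_part (triangle_rot (triangle_rot t))); rewrite // eq_sym -?xz // eq_sym.
have [yz|yz] := eqVneq (tag y) (tag z).
  by apply: (triangle_two_in_part (triangle_rot t)); rewrite // -yz.
have room a b c : triangle a b c -> tag a != tag b -> tag c != tag b -> k (tag b) = 1%N.
  move=> t' ab cb; apply/eqP; rewrite eqn_leq k_gt0 andbT leqNgt; apply/negP => kb.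
  by apply: (triangle_no_room t'); rewrite ?(negPf ab) ?(negPf cb).
have kx : k (tag x) = 1%N by apply: (room y x z); [apply: triangle_swap | rewrite eq_sym | rewrite eq_sym].
have ky : k (tag y) = 1%N by apply: (room x y z); rewrite // eq_sym.
have kz : k (tag z) = 1%N by apply: (room y z x); [apply: triangle_rot | |].
apply: (triangle_not_full t); split; first by rewrite !inE negb_or nxy.
  by rewrite cards2 nyz.
exists [set tag y; tag z].
  move=> s; rewrite sz_pair // !inE ![s == _]eq_sym.
  case: eqVneq => [<-|_]; first by rewrite ky eq_sym (negPf yz).
  by case: eqVneq => [<-|_]; rewrite ?kz.
by rewrite !inE (negPf xy) (negPf xz) kx.
Qed.

(** Edges meet pairwise and no vertex is on all of them. From an edge [a], [b], an edge missing [a]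
    must pass through [b] and one missing [b] through [a]; these two meet in a third vertex, closing
    a triangle. *)
Lemma maximal_absurd : False.
Proof.
have [a [b [ab tab]]] := edge_exists.
have star_or x y0 : x != y0 -> transversal [set x; y0] ->
    exists c d, [/\ c != d, transversal [set c; d], c != x & d != x].
  move=> xy0 txy; have y0x : y0 != x by rewrite eq_sym.
  case: (boolP [exists c, exists d, [&& c != d, transversal [set c; d], c != x & d != x]]).
    by case/existsP => c /existsP[d /and4P[]]; exists c, d.
  move=> no; exfalso; apply: (star_absurd (x := x) (y0 := y0)) => // c d cd tcd.
  apply: contraR no; rewrite negb_or => /andP[cx dx].
  by apply/existsP; exists c; apply/existsP; exists d; apply/and4P.
have other x y0 : x != y0 -> transversal [set x; y0] ->
    exists c, [/\ c != x, c != y0 & transversal [set y0; c]].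
  move=> xy0 txy; have [c [d [cd tcd cx dx]]] := star_or x y0 xy0 txy.
  have /pred0Pn[v /andP[/=]] := tr_meet txy tcd.
  rewrite !inE => /orP[] /eqP ->; first by rewrite ![x == _]eq_sym (negPf cx) (negPf dx).
  case/orP => /eqP e; first by exists d; rewrite e; split=> //; rewrite eq_sym.
  by exists c; rewrite e; split=> //; rewrite setUC.
have [c [ca cb tbc]] := other a b ab tab.
have tba : transversal [set b; a] by rewrite setUC.
have ba : b != a by rewrite eq_sym.
have [d [db da tad]] := other b a ba tba.
have /pred0Pn[v /andP[/=]] := tr_meet tbc tad.
rewrite !inE => /orP[] /eqP ->.
  by rewrite (negPf ba) eq_sym (negPf db).
rewrite (negPf ca) /= => /eqP cd.
apply: (@triangle_absurd a b c); split; split=> //; rewrite 1?eq_sym //.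
by rewrite cd.
Qed.

End MaximalFamily.
End Weights.

Theorem theorem1p1 (p : nat) (k : 'I_p -> nat) :
  0 < p -> (forall s, 1 <= k s) ->
  exists n0 : nat, forall n : 'I_p -> nat, (forall s, n0 <= n s) ->
    forall F : {set {set ground n}},
      (forall A, A \in F -> in_prod_binom k A) ->
      nontrivially_intersecting F ->
      #|F| <= Mmax n k.
Proof.
move=> p_gt0 k_gt0; exists (100 * (\sum_s k s) ^ 12) => n n_large F F_sub [F_int F_nt].
rewrite leqNgt; apply/negP => F_big.
(* Maximality is taken among intersecting families only; non-triviality passes to any larger
   family. *)
pose P (E : {set {set ground n}}) := (E \subset prodfam n k) &&
  [forall A in E, forall B in E, ~~ [disjoint A & B]].
have PF : P F.
  apply/andP; split.
    by apply/subsetP => A /F_sub hA; apply/prodfamP => s; rewrite -part_size.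
  by apply/forall_inP => A AF; apply/forall_inP => B BF; rewrite -setI_eq0 F_int.
have [E /maxsetP[/andP[/subsetP E_sub E_int] E_max] FE] := maxset_exists PF.
have E_meet A B : A \in E -> B \in E -> ~~ [disjoint A & B].
  by move=> AE BE; apply: (forall_inP (forall_inP E_int A AE)).
(* All weights are rational, so [rat] serves as the ordered field. *)
apply: (@maximal_absurd rat p n k k_gt0 n_large E p_gt0) => //.
- move=> A AP A_meet; suff <- : A |: E = E by rewrite !inE eqxx.
  apply: E_max; last exact: subsetUr.
  apply/andP; split.
    by apply/subsetP => B /setU1P[->|/E_sub].
  apply/forall_inP => B /setU1P[->|BE]; apply/forall_inP => C /setU1P[->|CE].
  (* The added set must also meet itself, which holds because it is nonempty. *)
  + have [s] : exists s : 'I_p, true by exists (Ordinal p_gt0).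
    rewrite -setI_eq0 setIid -card_gt0 card_sz (bigD1 s) //= ltn_addr //.
    by move/prodfamP: AP => ->; apply: k_gt0.
  + exact: A_meet.
  + by rewrite disjoint_sym; apply: A_meet.
  + exact: E_meet.
- move=> x; apply/exists_inP; rewrite -[X in is_true X]negbK; apply/negP => allx.
  apply: F_nt; exists x => A AF; move: allx; rewrite negb_exists_in.
  by move=> /forall_inP/(_ A (subsetP FE A AF)); rewrite negbK.
- exact: leq_trans F_big (subset_leq_card FE).
Qed.
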